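(* Let $q\ge2$ be an integer, let $m\in\mathbb N$, and let $\Pi$ be a random variable with values in a measurable space $(\Omega,\mathcal A)$. Suppose that $\{X_n\}_{n\ge1}$ conditioned on $\Pi$ is a stationary Markov chain of order $m-1$ with state space $\{0,\ldots,q-1\}$. Let $X=\sum_{n=1}^\infty X_nq^{-n}$, let $F_\Pi(x)=\mathrm P(X\le x\mid\Pi)$, and let $F=\mathrm E F_\Pi$ be the (unconditional) CDF of $X$. Then: (I) For any $x\in[0,1]$, $F$ has a discontinuity at $x$ if and only if $\mathrm P(\Pi\in A_x)>0$. (II) For any $x\in[0,1]$, $F$ is strictly increasing at $x$ if and only if $\mathrm P(\Pi\in B_x)>0$. (III) For Lebesgue almost all $x\in[0,1]$, $F'(x)=\mathrm P(F_\Pi=F_1)$.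
   Context: $\mathbb N=\{1,2,\ldots\}$. The random variable $\Pi$ specifies the conditional distribution of $\{X_n\}_{n\ge1}$ given $\Pi$; for $\pi\in\Omega$ write $F_\pi(x)=\mathrm P(X\le x\mid\Pi=\pi)$, $x\in\mathbb R$. $F_1$ denotes the uniform CDF on $[0,1]$ ($F_1(x)=x$ for $x\in[0,1]$). A CDF $G$ is strictly increasing at $x\in[0,1]$ if $G(s)<G(t)$ whenever $s<x<t$. For $x\in[0,1]$, $$A_x=\{\pi\in\Omega\mid F_\pi\text{ is discontinuous at }x\},\qquad B_x=\{\pi\in\Omega\mid F_\pi\text{ is strictly increasing at }x\}.$$ It is assumed that $A_x\in\mathcal A$, $B_x\in\mathcal A$ and $\{\pi\in\Omega\mid F_\pi=F_1\}\in\mathcal A$. A process $\{X_n\}_{n\ge1}$ is stationary if $\{X_n\}_{n\ge1}$ and $\{X_n\}_{n\ge2}$ are identically distributed. It is a Markov chain of order $m-1$ if the $X_n$ are independent when $m=1$, and, when $m>1$, the conditional distribution of $X_n$ given $X_1,\ldots,X_{n-1}$ depends only on $X_{n-m+1},\ldots,X_{n-1}$ for all $n\ge m$. A stationary Markov chain of order $m-1$ thus has finite dimensional probabilities, for $n\ge m$, $\mathrm P(X_1=x_1,\ldots,X_n=x_n)=\pi(x_1,\ldots,x_{m-1})\prod_{j=m}^n\pi_{x_{j-m+1},\ldots,x_j}$, where $\pi(x_1,\ldots,x_{m-1})=\mathrm P(X_1=x_1,\ldots,X_{m-1}=x_{m-1})$ (equal to $1$ if $m=1$) is an invariant initial distribution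 and $\pi_{x_1,\ldots,x_m}=\mathrm P(X_m=x_m\mid X_1=x_1,\ldots,X_{m-1}=x_{m-1})$ are the transition probabilities (with $\pi_{x_1}=\mathrm P(X_1=x_1)$ if $m=1$). *)

(* Defs.v *)
From HB Require Import structures.
From mathcomp Require Import all_boot all_order all_algebra finmap.
From mathcomp Require Import all_classical all_reals all_analysis.
From mathcomp Require Import measurable_realfun.

Set Implicit Arguments.
Unset Strict Implicit.
Unset Printing Implicit Defensive.

Import Order.TTheory GRing.Theory Num.Theory.
Import numFieldNormedType.Exports.

Local Open Scope classical_set_scope.
Local Open Scope ring_scope.

(* The state space {0, ..., q-1}. For q >= 1 the bound q.-1.+1 is q; as in the
   definition of 'Z_q, the successor form makes the type inhabited, which
   measurable types require. *)
Definition digit (q : nat) : Type := 'I_q.-1.+1.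

HB.instance Definition _ q := Finite.on (digit q).
HB.instance Definition _ q := isPointed.Build (digit q) ord0.
HB.instance Definition _ q := @isMeasurable.Build default_measure_display
  (digit q) discrete_measurable discrete_measurable0
  discrete_measurableC discrete_measurableU.

(* Sequences are indexed from 0: s : nat -> digit q stands for (x_1, x_2, ...)
   with x_n = s n.-1, and likewise X n below is the variable X_(n+1). *)
Definition coordinate_sets (q : nat) : set (set (nat -> digit q)) :=
  \bigcup_n preimage_set_system setT (fun s : nat -> digit q => s n) measurable.

Definition digitseq (q : nat) : Type :=
  g_sigma_algebraType (@coordinate_sets q).

Section processes.
Context {R : realType} {q : nat}.
Implicit Type mu : {measure set (digitseq q) -> \bar R}.

(* The predicates on mu are those of the coordinate process under mu, that is,
   of any process with law mu. *)
Definition stationary mu :=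
  forall C : set (digitseq q), measurable C ->
    mu [set s | C (fun n => s n.+1)] = mu C.

Definition independent_coordinates mu :=
  forall (J : {fset nat}) (A : nat -> set (digit q)),
    mu [set s | forall n, n \in J -> A n (s n)] =
    (\prod_(n <- J) mu [set s | A n (s n)])%E.

Definition cond_prob mu (A B : set (digitseq q)) : R :=
  fine (mu (A `&` B)) / fine (mu B).

Definition history (k : nat) (a : nat -> digit q) : set (digitseq q) :=
  [set s | forall i, (i < k)%N -> s i = a i].

(* In the second clause k = n - 1 is the index of X_n: the histories a and b of
   X_1, ..., X_(n-1) agree on the m - 1 last coordinates k - m + 1, ..., k - 1.
   Only histories of positive probability are conditioned on. *)
Definition markov_chain (m : nat) mu :=
  (m = 1%N -> independent_coordinates mu) /\
  ((1 < m)%N -> forall (k : nat) (a b : nat -> digit q), (m.-1 <= k)%N ->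
    (forall i, (i < k)%N -> (k < i + m)%N -> a i = b i) ->
    (0 < mu (history k a))%E -> (0 < mu (history k b))%E ->
    forall c : digit q,
      cond_prob mu [set s | s k = c] (history k a) =
      cond_prob mu [set s | s k = c] (history k b)).

End processes.

Definition expansion (R : realType) (q : nat) (s : nat -> digit q) : R :=
  limn (series (fun n => (s n : nat)%:R / q%:R ^+ n.+1 : R)).

Section conditioning.
Context {R : realType} {q : nat} {dT dO : measure_display}
  {T : measurableType dT} {Om : measurableType dO} {P : probability T R}.

(* kappa is a regular conditional distribution of the sequence X given Pi. *)
Definition conditional_distribution (X : nat -> {RV P >-> digit q})
    (Pi : {RV P >-> Om}) (kappa : R.-pker Om ~> digitseq q) :=
  forall (A : set Om) (C : set (digitseq q)), measurable A -> measurable C ->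
    P (Pi @^-1` A `&` [set t | C (fun n => X n t)]) =
    (\int[distribution P Pi]_(p in A) kappa p C)%E.

Definition cdf_expansion (X : nat -> {RV P >-> digit q}) (x : R) : R :=
  fine (P [set t | expansion R (fun n => X n t) <= x]).

Definition cdf_given (kappa : R.-pker Om ~> digitseq q) (p : Om) (x : R) : R :=
  fine (kappa p [set s | expansion R s <= x]).

End conditioning.

Definition uniform_cdf (R : realType) (x : R) : R :=
  fine (uniform_prob (@ltr01 R) `]-oo, x]).

Lemma uniform_cdfE (R : realType) (x : R) :
  0 <= x <= 1 -> uniform_cdf x = x.
Proof.
move=> /andP[x0 x1]; rewrite /uniform_cdf /uniform_prob integral_uniform_pdf.
rewrite (_ : _ `&` _ = `[0, x]%classic); last first.
  apply/seteqP; split=> y /=; rewrite !in_itv/=.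
    by move=> [yx /andP[-> _]].
  by move=> /andP[-> yx]; rewrite yx (le_trans yx).
rewrite (eq_integral (fun=> 1%E)) => [|y]; last first.
  rewrite inE/= in_itv/= /uniform_pdf => /andP[-> yx].
  by rewrite (le_trans yx x1)/= subr0 invr1.
rewrite integral_cst//= mul1e lebesgue_measure_itv/= lte_fin.
case: ifPn => [_|]; first by rewrite sube0.
by rewrite -leNgt => ?; apply/esym/le_anti; rewrite x0 andbT.
Qed.

Section points.
Context {R : realType}.

Definition discontinuous_at (G : R -> R) (x : R) :=
  ~ {for x, continuous G}.

Definition strictly_increasing_at (G : R -> R) (x : R) :=
  forall s t, s < x -> x < t -> G s < G t.

Context {q : nat} {dO : measure_display} {Om : measurableType dO}.
Context (kappa : R.-pker Om ~> digitseq q).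

Definition discontinuity_event (x : R) : set Om :=
  [set p | discontinuous_at (cdf_given kappa p) x].

Definition increase_event (x : R) : set Om :=
  [set p | strictly_increasing_at (cdf_given kappa p) x].

Definition uniform_event : set Om :=
  [set p | cdf_given kappa p = @uniform_cdf R].

End points.

Section facts.
Context {R : realType} {q : nat}.
Context (q2 : (2 <= q)%N).

Lemma is_cvg_expansion (s : nat -> digit q) :
  cvgn (series (fun n => (s n : nat)%:R / q%:R ^+ n.+1 : R)).
Proof.
have q0 : (0 : R) < q%:R by rewrite ltr0n; apply: leq_trans q2.
apply: (@series_le_cvg _ _ (fun n => geometric 1 (q%:R^-1 : R) n)) => [n|n|n|].
- by rewrite divr_ge0// exprn_ge0// ltW.
- by rewrite /geometric/= mul1r exprn_ge0// invr_ge0 ltW.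
- rewrite /geometric/= mul1r exprVn exprSr invfM mulrA mulrAC.
  rewrite ler_piMl ?invr_ge0 ?exprn_ge0 ?(ltW q0)//.
  rewrite ler_pdivrMr// mul1r ler_nat ltnW// (leq_trans (ltn_ord (s n)))//.
  by rewrite prednK// (leq_trans _ q2).
- apply: is_cvg_geometric_series.
  by rewrite ger0_norm ?invr_ge0 ?ltW// invf_lt1// ltr1n.
Qed.

Lemma measurable_coordinate n :
  measurable_fun setT (fun s : digitseq q => s n).
Proof.
move=> _ Y mY; rewrite setTI; apply: sub_sigma_algebra.
by exists n => //; exists Y => //; rewrite setTI.
Qed.

Lemma measurable_expansion :
  measurable_fun setT (fun s : digitseq q => expansion R s).
Proof.
pose h n (s : digitseq q) : R :=
  series (fun k => (s k : nat)%:R / q%:R ^+ k.+1) n.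
apply: (@measurable_fun_cvg _ _ _ _ h) => [n|s _].
- rewrite /h /series/=; apply: measurable_sum => k.
  apply: (@measurableT_comp _ _ _ _ _ _
    (fun x : digit q => (x : nat)%:R / q%:R ^+ k.+1 : R) _
    (fun s : digitseq q => s k)); first by [].
  exact: measurable_coordinate.
- exact: is_cvg_expansion.
Qed.

Context {dT dO : measure_display}
  {T : measurableType dT} {Om : measurableType dO} {P : probability T R}.

Lemma measurable_path (X : nat -> {RV P >-> digit q}) :
  measurable_fun setT (fun t => (fun n => X n t) : digitseq q).
Proof.
apply: measurability => //.
move=> _ [_ [n _ [B mB <-]] <-]; rewrite setTI.
rewrite setTI.
exact: (@measurable_funPTI _ _ _ _ (X n)).
Qed.

Lemma cdf_expansion_mixture (X : nat -> {RV P >-> digit q})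
    (Pi : {RV P >-> Om}) (kappa : R.-pker Om ~> digitseq q) :
  conditional_distribution X Pi kappa ->
  forall x, (cdf_expansion X x)%:E = 'E_P[fun t => cdf_given kappa (Pi t) x]%E.
Proof.
move=> h x.
have mC : measurable [set s : digitseq q | expansion R s <= x].
  rewrite -[X in measurable X]setTI.
  have := measurable_expansion measurableT (measurable_itv `]-oo, x]).
  by congr measurable; apply/seteqP; split=> s /=; rewrite in_itv.
have mX : measurable [set t | expansion R (fun n => X n t) <= x].
  by have := measurable_path X measurableT mC; rewrite setTI.
rewrite /cdf_expansion fineK ?fin_num_measure//.
have := h _ _ measurableT mC; rewrite preimage_setT setTI => ->.
rewrite ge0_integral_distribution//; last exact: measurable_kernel.
rewrite unlock; apply: eq_integral => t _ /=.
rewrite /cdf_given fineK// ge0_fin_numE//.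
rewrite (@le_lt_trans _ _ (kappa (Pi t) setT))//; last by rewrite prob_kernel ltry.
by apply: le_measure; rewrite ?inE//; exact: measurableT.
Qed.

End facts.

(* Main.v *)
(* Let lambda be the uniform law on digit sequences. An atom of X at x has mass
   E kappa(Pi, X = x), whence (I). For (II), the words of positive probability
   of a stationary Markov chain of order m - 1 are determined by those of length
   m, so the support of F_pi takes only finitely many values; if x lies outside
   almost all supports, then a single neighbourhood of x is missed by almost all
   of them.

   For (III), write F = P(F_Pi = F_1) F_1 + G. If F_pi <> F_1, some transition
   probability p of the chain, from a word u to a digit c, differs from 1 / q.
   The differences (count of uc) - p (count of u) among the first n blocks have
   orthogonal increments, so they are of order sqrt n in L^2 under pi, while under
   lambda the same holds with 1 / q in place of p for all words. Hence there are
   sets E_k depending on finitely many digits, the same for all pi, with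
   lambda(E_k) -> 1 and P(Pi <> uniform, X in E_k) -> 0. Away from the q-adic
   rationals E_k is a neighbourhood in [0, 1] of each of its points, so Vitali's
   covering lemma bounds the measure of the points where G has positive upper
   derivative, and G' = 0 almost everywhere. *)
Require Import Defs.
From HB Require Import structures.
From mathcomp Require Import all_boot all_order all_algebra finmap.
From mathcomp Require Import all_classical all_reals all_analysis.
From mathcomp Require Import measurable_realfun.
From mathcomp Require Import lra ring zify.

Import Order.TTheory GRing.Theory Num.Theory.
Import numFieldNormedType.Exports.

Local Open Scope classical_set_scope.
Local Open Scope ring_scope.

Set Implicit Arguments.
Unset Strict Implicit.
Unset Printing Implicit Defensive.

(** * Words, cylinders and laws of digit sequences *)

Section words.
Context {q : nat}.
Local Notation D := (digit q).
Implicit Types (s t : digitseq q) (u w : seq D) (A B : set (digitseq q)).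

Definition cylinder w : set (digitseq q) := [set s | mkseq s (size w) = w].

(** Padding with the digit 0 turns a word into a sequence, so that a set determined by its first
    digits can be tested on the word alone. *)
Definition extend w : nat -> D := nth ord0 w.

Definition determined_by N A :=
  forall s t, mkseq s N = mkseq t N -> A s -> A t.

Lemma mkseq_eqP N (a b : nat -> D) :
  mkseq a N = mkseq b N <-> (forall i, (i < N)%N -> a i = b i).
Proof.
split=> [ab i iN|ab].
  by rewrite -(nth_mkseq (a 0%N) a iN) ab nth_mkseq.
apply: (@eq_from_nth _ (a 0%N)); rewrite !size_mkseq// => i iN.
by rewrite !nth_mkseq// ab.
Qed.

Lemma historyE k (a : nat -> D) : history k a = cylinder (mkseq a k).
Proof.
by apply/seteqP; split=> s /=; rewrite /cylinder/= size_mkseq => /mkseq_eqP.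
Qed.

Lemma mkseq_extend w : mkseq (extend w) (size w) = w.
Proof. exact: mkseq_nth. Qed.

Lemma cylinder_mkseq s N : cylinder (mkseq s N) s.
Proof. by rewrite /cylinder/= size_mkseq. Qed.

Lemma cylinder_nil : cylinder [::] = setT.
Proof. by apply/seteqP; split. Qed.

Lemma cylinder_rcons w c :
  cylinder (rcons w c) = cylinder w `&` [set s | s (size w) = c].
Proof.
apply/seteqP; split=> s /=; rewrite /cylinder/= size_rcons mkseqS.
  by move/rcons_inj => [-> ->].
by move=> [-> ->].
Qed.

Lemma measurable_cylinder w : measurable (cylinder w).
Proof.
elim/last_ind: w => [|w c IH]; first by rewrite cylinder_nil.
rewrite cylinder_rcons; apply: measurableI => //.
have := measurable_coordinate (size w) measurableT (Y := [set c]) I.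
by rewrite setTI.
Qed.

Lemma determined_by_bigcup N A : determined_by N A ->
  A = \bigcup_(w in [set w | size w = N /\ A (extend w)]) cylinder w.
Proof.
move=> dA; apply/seteqP; split=> [s As|s [w [wN Aw] sw]].
  exists (mkseq s N); last exact: cylinder_mkseq.
  split; first by rewrite size_mkseq.
  by apply: dA As; have := mkseq_extend (mkseq s N); rewrite size_mkseq.
by apply: dA Aw; rewrite -wN mkseq_extend -[LHS]sw.
Qed.

Lemma determined_by_measurable N A : determined_by N A -> measurable A.
Proof.
move=> /determined_by_bigcup ->; rewrite bigcup_mkcond.
apply: countable_bigcupT_measurable; first exact: countableP.
by move=> w; case: ifP => // _; exact: measurable_cylinder.
Qed.

Lemma determined_by_leq M N A : (M <= N)%N ->
  determined_by M A -> determined_by N A.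
Proof.
move=> MN dA s t /mkseq_eqP st; apply: dA; apply/mkseq_eqP => i iM.
by apply: st; exact: leq_trans MN.
Qed.

Lemma determined_by_cylinder w : determined_by (size w) (cylinder w).
Proof. by move=> s t; rewrite /cylinder/= => ->. Qed.

End words.

(** * Sums over all words of a given length *)

Section wordsum.
Context {R : realType} {q : nat}.
Local Notation D := (digit q).
Implicit Types (g h : seq D -> R).

(** Recursion on the last digit matches the splitting of a cylinder into its one-digit refinements,
    so identities for all lengths follow by induction. *)
Fixpoint wordsum (N : nat) g : R :=
  if N is N'.+1 then wordsum N' (fun w => \sum_(c : D) g (rcons w c)) else g [::].

Lemma eq_wordsum N g h : (forall w, size w = N -> g w = h w) ->
  wordsum N g = wordsum N h.
Proof.
elim: N g h => [|N IH] g h gh /=; first exact: gh.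
by apply: IH => w wN; apply: eq_bigr => c _; apply: gh; rewrite size_rcons wN.
Qed.

Lemma le_wordsum N g h : (forall w, size w = N -> g w <= h w) ->
  wordsum N g <= wordsum N h.
Proof.
elim: N g h => [|N IH] g h gh /=; first exact: gh.
by apply: IH => w wN; apply: ler_sum => c _; apply: gh; rewrite size_rcons wN.
Qed.

Lemma wordsumD N g h :
  wordsum N (fun w => g w + h w) = wordsum N g + wordsum N h.
Proof.
elim: N g h => [//|N IH] g h /=; rewrite -IH.
by apply: eq_wordsum => w _; rewrite big_split.
Qed.

Lemma wordsumZ N g a : wordsum N (fun w => a * g w) = a * wordsum N g.
Proof.
elim: N g => [//|N IH] g /=; rewrite -IH.
by apply: eq_wordsum => w _; rewrite mulr_sumr.
Qed.

Lemma wordsum_gt0_ex N g : 0 < wordsum N g ->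
  exists2 w, size w = N & 0 < g w.
Proof.
move=> gN; apply: contrapT => /forall2NP H.
suff : wordsum N g <= wordsum N (fun=> 0 * 0).
  by rewrite wordsumZ mul0r leNgt gN.
apply: le_wordsum => w wN; rewrite mulr0.
by case: (H w) => // /negP; rewrite -leNgt.
Qed.

End wordsum.

(** * Real-valued probabilities under a law of digit sequences *)

Section law.
Context {R : realType} {q : nat} (mu : {measure set (digitseq q) -> \bar R}).
Context (mu1 : mu setT = 1%E).
Local Notation D := (digit q).
Implicit Types (s t : digitseq q) (u w : seq D) (A B : set (digitseq q)).

Definition pr A : R := fine (mu A).

Lemma prE A : measurable A -> (pr A)%:E = mu A.
Proof.
move=> mA; rewrite fineK// ge0_fin_numE// (@le_lt_trans _ _ (mu setT))//.
  by rewrite le_measure// inE.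
by rewrite mu1 ltry.
Qed.

Lemma pr_ge0 A : 0 <= pr A.
Proof. by rewrite fine_ge0. Qed.

Lemma prT : pr setT = 1.
Proof. by rewrite /pr mu1. Qed.

Lemma le_pr A B : measurable A -> measurable B -> A `<=` B -> pr A <= pr B.
Proof.
by move=> mA mB AB; rewrite -lee_fin !prE// le_measure// inE.
Qed.

Lemma pr_split A B : measurable A -> measurable B ->
  pr A = pr (A `&` B) + pr (A `\` B).
Proof.
move=> mA mB; apply/EFin_inj; rewrite EFinD !prE//; last 2 first.
  exact: measurableD.
  exact: measurableI.
by rewrite addeC -measureDI.
Qed.

Lemma pr_digits A n : measurable A ->
  pr A = \sum_(c : D) pr (A `&` [set s | s n = c]).
Proof.
move=> mA.
have mc c : measurable [set s : digitseq q | s n = c].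
  have := measurable_coordinate n measurableT (Y := [set c]) I.
  by rewrite setTI.
apply/EFin_inj; rewrite -sumEFin prE//.
rewrite (eq_bigr (fun c => mu (A `&` [set s | s n = c]))) => [|c _]; last first.
  by rewrite prE//; exact: measurableI.
pose F (c : 'I_q.-1.+1) := A `&` [set s | s n = c].
rewrite [A in LHS](_ : _ = \big[setU/set0]_(c < q.-1.+1) F c).
  rewrite measure_bigsetU_ord// => [c|].
    exact: measurableI.
  apply/trivIsetP => c d _ _ cd; rewrite -subset0 => s [[_ /= sc] [_ /= sd]].
  by move: cd; rewrite -sc -sd eqxx.
apply/seteqP; split=> s.
  by move=> As; rewrite -bigcup_seq; exists (s n) => //=; rewrite mem_index_enum.
by rewrite -bigcup_seq => -[c _ []].
Qed.
End law.

Section law_of_words.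
Context {R : realType} {q : nat} (mu : {measure set (digitseq q) -> \bar R}).
Context (mu1 : mu setT = 1%E).
Local Notation D := (digit q).
Local Notation pr := (pr mu).
Implicit Types (s t : digitseq q) (u w : seq D) (A B : set (digitseq q)).

Lemma pr_set0 : pr set0 = 0.
Proof. by rewrite /pr measure0. Qed.

Lemma pr_cylinderI w A : measurable A ->
  pr (A `&` cylinder w) = \sum_(c : D) pr (A `&` cylinder (rcons w c)).
Proof.
move=> mA; rewrite (pr_digits mu1 (size w)); last first.
  by apply: measurableI => //; exact: measurable_cylinder.
by apply: eq_bigr => c _; rewrite cylinder_rcons setIA.
Qed.

Lemma pr_cylinder w : pr (cylinder w) = \sum_(c : D) pr (cylinder (rcons w c)).
Proof.
have := @pr_cylinderI w setT measurableT; rewrite setTI => ->.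
by apply: eq_bigr => c _; rewrite setTI.
Qed.

Lemma le_pr_rcons w c : pr (cylinder (rcons w c)) <= pr (cylinder w).
Proof.
by apply: (le_pr mu1); rewrite ?cylinder_rcons//;
  [rewrite -cylinder_rcons|]; exact: measurable_cylinder.
Qed.

Lemma pr_wordsum N A : measurable A ->
  pr A = wordsum N (fun w => pr (A `&` cylinder w)).
Proof.
move=> mA; elim: N => [|N IH] /=; first by rewrite cylinder_nil setIT.
by rewrite IH; apply: eq_wordsum => w _; exact: pr_cylinderI.
Qed.

Lemma wordsum_pr N : wordsum N (fun w => pr (cylinder w)) = 1.
Proof.
rewrite -(prT mu1) (pr_wordsum N measurableT).
by apply: eq_wordsum => w _; rewrite setTI.
Qed.

End law_of_words.

(** * Block counts *)

Section deviation.
Context {R : realType} {q : nat}.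
Local Notation D := (digit q).
Implicit Types (s t : nat -> D) (u w : seq D).

Definition occurs u k s := mkseq (fun i => s (k + i)%N) (size u) == u.

Definition count_block u n s : R := \sum_(k < n) (occurs u k s)%:R.

Definition deviation u c (p : R) n s : R :=
  count_block (rcons u c) n s - p * count_block u n s.

Lemma occurs_rcons u c k s :
  occurs (rcons u c) k s = occurs u k s && (s (k + size u)%N == c).
Proof. by rewrite /occurs size_rcons mkseqS eqseq_rcons. Qed.

(** The increment vanishes unless [u] occurs at position [n]; there it is a centred indicator of the
    next digit, of conditional mean zero when [p] is the transition probability. *)
Lemma deviationS u c p n s : deviation u c p n.+1 s =
  deviation u c p n s +
  (occurs u n s)%:R * ((s (n + size u)%N == c)%:R - p).
Proof.
rewrite /deviation /count_block !big_ord_recr/= occurs_rcons.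
rewrite -mulnb natrM; ring.
Qed.

Lemma eq_occurs u k s t N : (k + size u <= N)%N ->
  mkseq s N = mkseq t N -> occurs u k s = occurs u k t.
Proof.
move=> kN /mkseq_eqP st; rewrite /occurs; congr (_ == _).
apply/mkseq_eqP => i iu; apply: st.
by apply: leq_trans kN; rewrite ltn_add2l.
Qed.

(** The last position counted is [n.-1]. The digit saved here lets [n + size u] digits suffice for
    [rcons u c] as well. *)
Lemma eq_count_block u n s t N : (n.-1 + size u <= N)%N ->
  mkseq s N = mkseq t N -> count_block u n s = count_block u n t.
Proof.
move=> nN st; apply: eq_bigr => k _; congr (_%:R).
rewrite (eq_occurs _ st)//; apply: leq_trans nN.
by rewrite leq_add2r; case: n k => [[]//|n [k]] /=; rewrite ltnS.
Qed.

Lemma eq_deviation u c p n s t N : (n + size u <= N)%N ->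
  mkseq s N = mkseq t N -> deviation u c p n s = deviation u c p n t.
Proof.
case: n => [|n] nN st; first by rewrite /deviation /count_block !big_ord0.
rewrite /deviation (@eq_count_block (rcons u c) _ _ _ _ _ st)/=; last first.
  by rewrite size_rcons addnS -addSn.
by rewrite (@eq_count_block u _ _ _ _ _ st)//= (leq_trans _ nN)// leq_add2r.
Qed.

Context (mu : {measure set (digitseq q) -> \bar R}) (mu1 : mu setT = 1%E).
Local Notation pr := (pr mu).

Lemma extend_rcons w c : mkseq (extend (rcons w c)) (size w) = w.
Proof.
apply: (@eq_from_nth _ ord0); rewrite size_mkseq// => i iw.
by rewrite nth_mkseq// /extend nth_rcons iw.
Qed.

Lemma occursP u k s : (occurs u k s) ->
  mkseq s (k + size u) = mkseq s k ++ u.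
Proof.
move=> /eqP sk; rewrite /mkseq iotaD map_cat add0n; congr (_ ++ _).
by rewrite -{2}sk /mkseq -{1}(addn0 k) iotaDl -map_comp.
Qed.

(* The increments of the deviation are orthogonal under mu. *)
Lemma deviation_second_moment u c p n : 0 <= p <= 1 ->
  (forall v, pr (cylinder (rcons (v ++ u) c)) = p * pr (cylinder (v ++ u))) ->
  wordsum (n + size u)
    (fun w => deviation u c p n (extend w) ^+ 2 * pr (cylinder w)) <= n%:R.
Proof.
move=> /andP[p0 p1] hp; elim: n => [|n IH].
  rewrite (@eq_wordsum _ _ _ _ (fun=> 0 * 0)) ?wordsumZ ?mul0r// => w _.
  by rewrite /deviation /count_block !big_ord0 mulr0 subrr expr0n !mul0r.
(* The new unit is written as the total mass of the words of length [n + size u], so that the bound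
   can be checked word by word. *)
rewrite addSn/= -natr1 -[X in _ <= _ + X](wordsum_pr mu1 (n + size u)).
apply: le_trans (lerD IH (lexx _)); rewrite -wordsumD.
apply: le_wordsum => w wn; set d := deviation u c p n (extend w).
have dE e : deviation u c p n.+1 (extend (rcons w e)) =
    d + (occurs u n (extend w))%:R * ((e == c)%:R - p).
  have ext : mkseq (extend (rcons w e)) (n + size u) =
      mkseq (extend w) (n + size u) by rewrite -wn extend_rcons mkseq_extend.
  rewrite deviationS (eq_deviation _ _ (leqnn _) ext) (eq_occurs (leqnn _) ext).
  by rewrite -wn /extend nth_rcons ltnn eqxx.
have [ou|ou] := boolP (occurs u n (extend w)); last first.
  under eq_bigr do rewrite dE (negbTE ou) mul0r addr0.
  by rewrite -mulr_sumr -pr_cylinder// ler_wpDr// pr_ge0.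
under eq_bigr do rewrite dE ou mul1r.
(* An occurrence of [u] at [n] means that [w] ends in [u], so the hypothesis on [p] applies to
   [w]. *)
have prc : pr (cylinder (rcons w c)) = p * pr (cylinder w).
  have := occursP ou; rewrite -wn mkseq_extend => ->; exact: hp.
rewrite [X in _ <= _ + X](pr_cylinder mu1 w).
rewrite {1}(pr_cylinder mu1 w) mulr_sumr -big_split/=.
pose f e := pr (cylinder (rcons w e)).
(* Given [w], the increment has mean zero, which removes the cross term of the square. *)
have orth : \sum_(e : D) ((e == c)%:R - p) * f e = 0.
  under eq_bigr do rewrite mulrBl.
  rewrite sumrB -mulr_sumr -(pr_cylinder mu1 w) -prc.
  rewrite (bigD1 c)//= eqxx mul1r big1 ?addr0 ?subrr// => e /negbTE ->.
  by rewrite mul0r.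
rewrite (eq_bigr (fun e => (2 * d) * (((e == c)%:R - p) * f e) +
   (d ^+ 2 * f e + ((e == c)%:R - p) ^+ 2 * f e))); last first.
  by move=> e _; rewrite -/(f e); ring.
rewrite big_split/= -mulr_sumr orth mulr0 add0r.
apply: ler_sum => e _; rewrite lerD2l// ler_piMl ?pr_ge0//.
by case: eqP => _ /=; nra.
Qed.

(** Each word of the event contributes at least [a ^+ 2] times its probability to the second
    moment. *)
Lemma deviation_chebyshev u c p n a : 0 <= p <= 1 -> 0 < a ->
  (forall v, pr (cylinder (rcons (v ++ u) c)) = p * pr (cylinder (v ++ u))) ->
  pr [set s | a <= `|deviation u c p n s|] <= n%:R / a ^+ 2.
Proof.
move=> p01 a0 hp; set A := [set s | _].
have dA : determined_by (n + size u) A.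
  by move=> s t st; rewrite /A/= (@eq_deviation _ _ _ _ _ _ _ (leqnn _) st).
rewrite (pr_wordsum mu1 (n + size u)); last exact: determined_by_measurable dA.
rewrite ler_pdivlMr ?exprn_gt0// mulrC -wordsumZ.
apply: le_trans (deviation_second_moment _ p01 hp).
apply: le_wordsum => w wn.
have [wA|wA] := pselect (A (extend w)); last first.
  have -> : A `&` cylinder w = set0; last first.
    by rewrite pr_set0 mulr0 mulr_ge0 ?sqr_ge0 ?pr_ge0.
  rewrite -subset0 => s [As ws]; apply: wA; apply: dA As.
  by rewrite -wn mkseq_extend.
rewrite ler_pM ?pr_ge0 ?sqr_ge0//.
  by rewrite -[leRHS]real_normK ?num_real// lerXn2r ?nnegrE// ltW.
apply: (le_pr mu1) => //; last exact: measurable_cylinder.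
by apply: measurableI; [exact: determined_by_measurable dA|exact: measurable_cylinder].
Qed.

End deviation.

(** * Stationary Markov chains *)

Section markov.
Context {R : realType} {q : nat} (mu : {measure set (digitseq q) -> \bar R}).
Context (mu1 : mu setT = 1%E).
Local Notation D := (digit q).
Local Notation pr := (pr mu).
Implicit Types (s t : digitseq q) (u w : seq D) (A B : set (digitseq q)).

Lemma determined_by_shift N j A : determined_by N A ->
  determined_by (j + N) [set s | A (fun i => s (j + i)%N)].
Proof.
move=> dA s t /mkseq_eqP st; apply: dA; apply/mkseq_eqP => i iN.
by apply: st; rewrite ltn_add2l.
Qed.

Lemma occurs_cylinder u j :
  [set s | occurs u j s] = [set s | cylinder u (fun i => s (j + i)%N)].
Proof. by apply/seteqP; split=> s /eqP. Qed.

Lemma determined_by_occurs u j :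
  determined_by (j + size u) [set s : digitseq q | occurs u j s].
Proof.
by rewrite occurs_cylinder; apply: determined_by_shift; exact: determined_by_cylinder.
Qed.

Lemma measurable_occurs u j : measurable [set s : digitseq q | occurs u j s].
Proof. exact: determined_by_measurable (determined_by_occurs (u:=u) (j:=j)). Qed.

Lemma cylinder_cat v u :
  cylinder (v ++ u) = [set s | occurs u (size v) s] `&` cylinder v.
Proof.
apply/seteqP; split=> s.
  move=> sE; have sE' : mkseq s (size v + size u) = v ++ u by rewrite -size_cat.
  have sv : mkseq s (size v) = v.
    have /(congr1 (take (size v))) := sE'.
    by rewrite take_size_cat// /mkseq -map_take take_iota (minn_idPl (leq_addr _ _)).
  split=> //=; apply/eqP.
  have /(congr1 (drop (size v))) := sE'.
  rewrite drop_size_cat// /mkseq -map_drop drop_iota add0n addKn => <-.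
  by rewrite -[in RHS](addn0 (size v)) iotaDl -map_comp size_map size_iota.
by move=> [/occursP/= su sv]; rewrite /cylinder/= size_cat su sv.
Qed.

Lemma pr_shift j A N : stationary mu -> determined_by N A ->
  pr [set s | A (fun i => s (j + i)%N)] = pr A.
Proof.
move=> st dA; elim: j => // j <-.
have mj : measurable [set s : digitseq q | A (fun i => s (j + i)%N)].
  exact: determined_by_measurable (determined_by_shift (j:=j) dA).
rewrite /pr -(st _ mj); congr (fine (mu _)).
Qed.

Lemma pr_occurs u j : stationary mu -> pr [set s | occurs u j s] = pr (cylinder u).
Proof.
by move=> st; rewrite occurs_cylinder (pr_shift j st (determined_by_cylinder (w:=u))).
Qed.

(** Summing out the first [j] digits leaves the event that [u] occurs at position [j], and
    stationarity moves it to position 0. *)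
Lemma wordsum_prefix j u : stationary mu ->
  wordsum j (fun v => pr (cylinder (v ++ u))) = pr (cylinder u).
Proof.
move=> st; rewrite -(pr_occurs u j st) (pr_wordsum mu1 j); last exact: measurable_occurs.
by apply: eq_wordsum => v <-; rewrite cylinder_cat.
Qed.

Lemma pr_gt0 A : 0 < pr A -> (0 < mu A)%E.
Proof. by rewrite /pr; case: (mu A) => [r||] /=; rewrite ?ltxx ?lte_fin. Qed.

Lemma pr_cat_le v u : stationary mu -> pr (cylinder (v ++ u)) <= pr (cylinder u).
Proof.
move=> st; rewrite -(pr_occurs u (size v) st) cylinder_cat.
apply: (le_pr mu1) => //; last exact: measurable_occurs.
by apply: measurableI; [exact: measurable_occurs|exact: measurable_cylinder].
Qed.

(** Independence separates the last position from the others, and stationarity moves the digit there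
    to position 0. *)
Lemma independent_rcons w c : stationary mu -> independent_coordinates mu ->
  pr (cylinder (rcons w c)) = pr (cylinder w) * pr (cylinder [:: c]).
Proof.
move=> st ind.
pose a := extend (rcons w c).
pose J : {fset nat} := [fset i | i in iota 0 (size w)]%fset.
have JE n : (n \in J) = (n < size w)%N by rewrite inE/= mem_iota.
have wE : cylinder w = [set s | forall n, n \in J -> [set a n] (s n)].
  apply/seteqP; split=> s.
    move=> ws n; rewrite JE => nw; rewrite /= /a /extend nth_rcons nw.
    by rewrite -{1}ws nth_mkseq.
  move=> sa; rewrite /cylinder/=; apply: (@eq_from_nth _ ord0); rewrite size_mkseq// => i iw.
  by rewrite nth_mkseq// (sa i) ?JE// /a /extend nth_rcons iw.
have wcE : cylinder (rcons w c) =
    [set s | forall n, n \in (size w |` J)%fset -> [set a n] (s n)].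
  have aw : a (size w) = c by rewrite /a /extend nth_rcons ltnn eqxx.
  rewrite cylinder_rcons wE; apply/seteqP; split=> s.
    by move=> [sJ sc] n /fset1UP[->|/sJ//]; rewrite aw.
  move=> sJ; split; first by move=> n nJ; apply: sJ; exact: fset1Ur.
  by rewrite -aw; apply: sJ; exact: fset1U1.
have mc n : measurable [set s : digitseq q | [set a n] (s n)].
  have := measurable_coordinate n measurableT (Y := [set a n]) I.
  by rewrite setTI.
have indE (K : {fset nat}) : mu [set s | forall n, n \in K -> [set a n] (s n)] =
    (\prod_(n <- K) mu [set s | [set a n] (s n)])%E := ind K (fun n => [set a n]).
rewrite /pr wcE wE !indE big_fsetU1 ?JE ?ltnn//= mulrC fineM; last 2 first.
- by rewrite -(prE mu1 (mc _)).
- by apply: prode_fin_num => i _; rewrite -(prE mu1 (mc _)).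
congr (_ * _).
rewrite -[RHS]/(pr _) -(pr_occurs [:: c] (size w) st); congr (fine (mu _)).
apply/seteqP; split=> s /=; rewrite /occurs /mkseq /= /a /extend nth_rcons ltnn eqxx addn0.
  by move=> ->; rewrite eqxx.
by move=> /eqP[].
Qed.

(* The Markov property cleared of denominators. *)
Lemma pr_rcons_markov m v u c : (0 < m)%N -> stationary mu -> markov_chain m mu ->
  size u = m.-1 ->
  pr (cylinder (rcons (v ++ u) c)) * pr (cylinder u) =
  pr (cylinder (v ++ u)) * pr (cylinder (rcons u c)).
Proof.
move=> m0 st [mk1 mk] um.
have [m1|m1] : m = 1%N \/ (1 < m)%N by case: m m0 {mk1 mk um} => [//|[|m]]; [left|right].
  case: u um => [|//]; rewrite m1 // => _.
  by rewrite cats0 (independent_rcons _ _ st (mk1 m1)) cylinder_nil (prT mu1) mulr1.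
(* Two histories of the same length ending in [u] have the same transition probability to [c]; the
   product form also covers histories of probability 0. *)
have key v' : size v' = size v ->
    pr (cylinder (rcons (v' ++ u) c)) * pr (cylinder (v ++ u)) =
    pr (cylinder (rcons (v ++ u) c)) * pr (cylinder (v' ++ u)).
  move=> vv.
  have zero z (x : R) : pr (cylinder z) <= 0 -> pr (cylinder (rcons z c)) * x = 0.
    move=> z0; suff /eqP -> : pr (cylinder (rcons z c)) == 0 by rewrite mul0r.
    by rewrite eq_le pr_ge0 andbT; apply: le_trans z0; exact: (le_pr_rcons mu1).
  have zero' z (x : R) : pr (cylinder z) <= 0 -> x * pr (cylinder z) = 0.
    move=> z0; suff /eqP -> : pr (cylinder z) == 0 by rewrite mulr0.
    by rewrite eq_le pr_ge0 andbT.
  have [p0|p0] := leP (pr (cylinder (v' ++ u))) 0.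
    by rewrite (zero (v' ++ u))// (zero' (v' ++ u)).
  have [r0|r0] := leP (pr (cylinder (v ++ u))) 0.
    by rewrite (zero (v ++ u))// (zero' (v ++ u)).
  have hE z : size z = size v ->
      history (size v + size u) (extend (z ++ u)) = cylinder (z ++ u).
    by move=> zv; rewrite historyE -zv -size_cat mkseq_extend.
  have leuk : (m.-1 <= size v + size u)%N by rewrite um leq_addl.
  have agree i : (i < size v + size u)%N -> (size v + size u < i + m)%N ->
      extend (v' ++ u) i = extend (v ++ u) i.
    rewrite um => ik ki; have vi : (size v <= i)%N by move: m0 ki; lia.
    by rewrite /extend !nth_cat vv ltnNge vi.
  have rE z : size z = size v -> [set s | s (size v + size u)%N = c] `&` cylinder (z ++ u) =
      cylinder (rcons (z ++ u) c).
    by move=> zv; rewrite cylinder_rcons setIC size_cat zv.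
  have := mk m1 (size v + size u)%N (extend (v' ++ u)) (extend (v ++ u)) leuk agree.
  rewrite !hE// => /(_ (pr_gt0 p0) (pr_gt0 r0) c); rewrite /cond_prob !rE// => H.
  have {H} : pr (cylinder (rcons (v' ++ u) c)) / pr (cylinder (v' ++ u)) =
    pr (cylinder (rcons (v ++ u) c)) / pr (cylinder (v ++ u)) by [].
  move=> /(congr1 (fun x => x * pr (cylinder (v' ++ u)) * pr (cylinder (v ++ u)))).
  rewrite divfK ?gt_eqF// => ->.
  by rewrite mulrAC divfK ?gt_eqF.
(* Summing [key] over all [v'] turns the factors containing [v'] into the probabilities of [u] and
   of [rcons u c]. *)
rewrite -(wordsum_prefix (size v) u st) -wordsumZ.
rewrite mulrC -(wordsum_prefix (size v) (rcons u c) st) mulrC -wordsumZ.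
apply: eq_wordsum => v' vv; rewrite -key// mulrC; congr (_ * _).
by rewrite rcons_cat.
Qed.

End markov.

(** * Transition probabilities and typical sequences *)

Section transition.
Context {R : realType} {q : nat} (m : nat).
Context (q2 : (2 <= q)%N) (m0 : (0 < m)%N).
Local Notation D := (digit q).
Implicit Types (u v w : seq D) (mu : {measure set (digitseq q) -> \bar R}).

Definition stationary_markov mu :=
  [/\ mu setT = 1%E, stationary mu & markov_chain m mu].

Lemma split_last k w : (k <= size w)%N ->
  exists v u, w = v ++ u /\ size u = k.
Proof.
move=> kw; exists (take (size w - k) w), (drop (size w - k) w).
by rewrite cat_take_drop size_drop subKn.
Qed.

(** A positive word shorter than [m] has a positive continuation of length [m]. Beyond length [m],
    the Markov property makes [rcons w c] positive as soon as [w] and its last [m] letters including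
    [c] are. *)
Lemma positive_cylinders mu mu' :
  stationary_markov mu -> stationary_markov mu' ->
  (forall w, size w = m -> 0 < pr mu (cylinder w) -> 0 < pr mu' (cylinder w)) ->
  forall w, 0 < pr mu (cylinder w) -> 0 < pr mu' (cylinder w).
Proof.
move=> [mu1 st mk] [mu1' st' mk'] H.
have short d w : (size w + d = m)%N ->
    0 < pr mu (cylinder w) -> 0 < pr mu' (cylinder w).
  elim: d w => [|d IH] w; first by rewrite addn0; exact: H.
  move=> wd; rewrite (pr_cylinder mu1) => pw.
  have [c cw] : exists c, 0 < pr mu (cylinder (rcons w c)).
    apply: contrapT => /forallNP H'; move: pw; rewrite ltNge sumr_le0// => c _.
    by rewrite leNgt; apply/negP.
  apply: lt_le_trans (le_pr_rcons mu1' w c); apply: IH => //.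
  by rewrite size_rcons addSnnS.
move=> w; have [mw|/ltnW mw] := leqP m (size w); last first.
  by apply: (short (m - size w)%N); rewrite subnKC.
elim/last_ind: w mw => [|w c IH] mw pw; first by apply: (short m).
have [?|mw'] := eqVneq (size (rcons w c)) m; first exact: H.
have {mw mw'} mw : (m <= size w)%N.
  by move: mw mw'; rewrite size_rcons leq_eqVlt eq_sym => /orP[->//|].
have pw' : 0 < pr mu' (cylinder w).
  by apply: IH => //; apply: lt_le_trans (le_pr_rcons mu1 w c).
have [v [u [wE um]]] : exists v u, w = v ++ u /\ size u = m.-1.
  by apply: split_last; apply: leq_trans mw; exact: leq_pred.
have uc : 0 < pr mu' (cylinder (rcons u c)).
  apply: H; first by rewrite size_rcons um prednK.
  by apply: lt_le_trans (pr_cat_le mu1 v _ st); rewrite -rcons_cat -wE.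
have := mulr_gt0 pw' uc; rewrite wE -(pr_rcons_markov mu1' v c m0 st' mk' um).
by rewrite pmulr_lgt0//; apply: lt_le_trans uc (le_pr_rcons mu1' u c).
Qed.

(* p is the transition probability from u to c. When u has probability 0 it is 0
   by the convention x / 0 = 0, and still differs from 1 / q. *)
Lemma uniform_or_biased mu : stationary_markov mu ->
  (forall w, pr mu (cylinder w) = q%:R^-1 ^+ size w) \/
  exists u c (p : R), [/\ size u = m.-1, 0 <= p <= 1, p != q%:R^-1 &
    forall v, pr mu (cylinder (rcons (v ++ u) c)) = p * pr mu (cylinder (v ++ u))].
Proof.
move=> [mu1 st mk].
pose p u c := pr mu (cylinder (rcons u c)) / pr mu (cylinder u).
have [H|] := pselect (forall u c, size u = m.-1 -> p u c = q%:R^-1); last first.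
  move=> /existsNP[u /existsNP[c /not_implyP[um /eqP pq]]]; right.
  exists u, c, (p u c); split=> //.
    rewrite /p divr_ge0 ?pr_ge0//=.
    have [->|u0] := eqVneq (pr mu (cylinder u)) 0; first by rewrite invr0 mulr0.
    by rewrite ler_pdivrMr ?mul1r ?le_pr_rcons// lt_neqAle eq_sym u0 pr_ge0.
  move=> v; have := pr_rcons_markov mu1 v c m0 st mk um.
  have [u0|u0] := eqVneq (pr mu (cylinder u)) 0.
    have vu0 : pr mu (cylinder (v ++ u)) = 0.
      by apply/eqP; rewrite eq_le pr_ge0 andbT -u0 pr_cat_le.
    move=> _; rewrite vu0 mulr0; apply/eqP; rewrite eq_le pr_ge0 andbT -[leRHS]vu0.
    exact: le_pr_rcons.
  move=> /(congr1 (fun x => x / pr mu (cylinder u))).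
  by rewrite mulfK// => ->; rewrite -mulrA mulrC.
left.
have q0 : (q%:R^-1 : R) != 0 by rewrite invr_neq0// pnatr_eq0; case: q q2.
have step v u c : size u = m.-1 ->
    pr mu (cylinder (rcons (v ++ u) c)) = q%:R^-1 * pr mu (cylinder (v ++ u)).
  (* If [u] were null, the quotient defining its transition probability would be 0 by convention,
     not 1 / q. *)
  move=> um; have u0 : pr mu (cylinder u) != 0.
    apply: contraNneq q0 => u0; rewrite -(H u c um) /p u0 invr0 mulr0.
    by [].
  apply: (mulIf u0); rewrite (pr_rcons_markov mu1 v c m0 st mk um).
  have /(congr1 (fun x => x * pr mu (cylinder u))) := H u c um.
  by rewrite /p divfK// => ->; rewrite mulrA (mulrC _ q%:R^-1).
have ext u w : size u = m.-1 ->
    pr mu (cylinder (u ++ w)) = q%:R^-1 ^+ size w * pr mu (cylinder u).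
  move=> um; elim/last_ind: w => [|w c IH]; first by rewrite cats0 mul1r.
  have [v [u' [wE um']]] : exists v u', u ++ w = v ++ u' /\ size u' = m.-1.
    by apply: split_last; rewrite size_cat um leq_addr.
  by rewrite -rcons_cat wE step// -wE IH size_rcons exprS mulrA.
(* Prepending [m.-1] digits by stationarity brings words of every length, also those shorter than
   the memory, under [ext]. *)
move=> w; rewrite -(wordsum_prefix mu1 m.-1 w st).
rewrite (eq_wordsum (h := fun v => q%:R^-1 ^+ size w * pr mu (cylinder v))).
  by rewrite wordsumZ (wordsum_pr mu1) mulr1.
by move=> v vm; exact: ext.
Qed.

(* The tolerance k ^ 3 is negligible before the k ^ 4 positions that are counted,
   and the Chebyshev bound k ^ 4 / (k ^ 3) ^ 2 tends to 0. *)
Definition typical (k : nat) : set (digitseq q) :=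
  [set s | forall u c, (size u < m)%N ->
    `|deviation u c (q%:R^-1 : R) (k ^ 4) s| < k%:R ^+ 3].

Lemma determined_by_typical k : determined_by (k ^ 4 + m) (typical k).
Proof.
move=> s t st; rewrite /typical /= => H u c um.
rewrite -(eq_deviation _ _ (leqnn _) (_ : mkseq s _ = mkseq t _)); first exact: H.
apply/mkseq_eqP => i iu; move/mkseq_eqP : st; apply.
by apply: leq_trans iu _; rewrite leq_add2l ltnW.
Qed.

Lemma measurable_typical k : measurable (typical k).
Proof. exact: determined_by_measurable (determined_by_typical (k:=k)). Qed.

Lemma invq_itv01 : 0 <= (q%:R^-1 : R) <= 1.
Proof.
have q0 : (0 < q)%N by apply: leq_trans q2.
by rewrite invr_ge0 ler0n/= invf_le1 ?ltr0n// ler1n.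
Qed.

(** Each further letter scales the error made so far by 1 / q, which is at most 1, and adds one
    tolerance [k%:R ^+ 3]. *)
Lemma count_typical k s w : typical k s -> (size w <= m)%N ->
  `|count_block w (k ^ 4) s - (k ^ 4)%:R * (q%:R^-1 : R) ^+ size w| <=
  (size w)%:R * k%:R ^+ 3.
Proof.
move=> Es; elim/last_ind: w => [|w c IH] wm.
  rewrite mulr1 mul0r /count_block.
  under eq_bigr do rewrite /occurs/=.
  by rewrite sumr_const card_ord subrr normr0.
move: wm; rewrite size_rcons => wm.
have /ltW := Es w c wm; rewrite /deviation => H1.
have {}IH := IH (ltnW wm).
have /andP[q0 q1] := invq_itv01.
rewrite (_ : _ - _ = (count_block (rcons w c) (k ^ 4) s - q%:R^-1 * count_block w (k ^ 4) s)
  + q%:R^-1 * (count_block w (k ^ 4) s - (k ^ 4)%:R * (q%:R^-1 : R) ^+ size w)); last first.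
  by rewrite exprS; ring.
apply: (le_trans (ler_normD _ _)); rewrite -natr1 mulrDl mul1r addrC lerD//.
rewrite normrM ger0_norm//; apply: le_trans IH.
by rewrite ler_piMl.
Qed.

(** In a typical sequence the word [u] of a biased transition occurs about k^4 / q^(m-1) times, and
    about 1 / q of these occurrences are followed by [c]. Relative to the true [p] the deviation is
    then of order k^4, above the tolerance k^3, and Chebyshev bounds this event by k^4 / k^6. The
    threshold [K] depends on the bias, hence on [mu]. *)
Lemma typical_pr mu : stationary_markov mu ->
  (exists w, pr mu (cylinder w) != q%:R^-1 ^+ size w) ->
  exists K, forall k, (K <= k)%N -> pr mu (typical k) <= (k%:R ^- 2).
Proof.
move=> mumk [w0 w0E].
have [H|[u [c [p [um p01 pq hp]]]]] := uniform_or_biased mumk.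
  by rewrite H eqxx in w0E.
have [mu1 _ _] := mumk.
pose d := `|p - q%:R^-1|; have d0 : 0 < d by rewrite normr_gt0 subr_eq0.
pose b := (q%:R^-1 : R) ^+ m.-1.
have b0 : 0 < b by rewrite exprn_gt0// invr_gt0 ltr0n (leq_trans _ q2).
(* Solves [d * (k * b - m) = 2] for [k], which is what [big] requires. *)
pose x := (2 / d + m%:R) / b.
exists (Num.truncn x).+1 => k Kk.
have xk : x < k%:R by apply: lt_le_trans (truncnS_gt _) _; rewrite ler_nat.
have k0 : 0 < k%:R :> R by rewrite ltr0n; case: k Kk {xk}.
have k30 : 0 < k%:R ^+ 3 :> R by rewrite exprn_gt0.
have sub : typical k `<=` [set s | k%:R ^+ 3 <= `|deviation u c p (k ^ 4) s|].
  move=> s Es /=.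
  have := Es u c; rewrite um prednK// => /(_ (leqnn _)) /ltW Eu.
  have := @count_typical k s u Es; rewrite um => /(_ (leq_pred _)) Cu.
  have {Cu} Cu : (k ^ 4)%:R * b - m%:R * k%:R ^+ 3 <= count_block u (k ^ 4) s.
    have mm : m.-1%:R * k%:R ^+ 3 <= m%:R * k%:R ^+ 3 :> R.
      by apply: ler_wpM2r; [exact: ltW|rewrite ler_nat leq_pred].
    by move: Cu; rewrite ler_distl -/b => /andP[+ _]; apply: le_trans; rewrite lerD2l lerN2.
  (* One of the two terms [k%:R ^+ 3] absorbs the deviation relative to 1 / q; the other remains as
     the lower bound. *)
  have big : 2 * k%:R ^+ 3 <= d * count_block u (k ^ 4) s.
    apply: (@le_trans _ _ (d * ((k ^ 4)%:R * b - m%:R * k%:R ^+ 3))); last first.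
      by apply: ler_wpM2l => //; exact: ltW.
    rewrite natrX (_ : _ * _ = d * (k%:R * b - m%:R) * k%:R ^+ 3); last ring.
    apply: ler_wpM2r; first exact: ltW.
    by move: xk; rewrite /x ltr_pdivrMr// -ltrBrDr ltr_pdivrMr// mulrC => /ltW.
  have c0 : 0 <= count_block u (k ^ 4) s :> R by apply: sumr_ge0.
  rewrite (_ : deviation u c p _ s = deviation u c q%:R^-1 (k ^ 4) s -
     (p - q%:R^-1) * count_block u (k ^ 4) s); last by rewrite /deviation; ring.
  rewrite distrC; apply: le_trans (lerB_normD _ _); rewrite normrN normrM -/d (ger0_norm c0).
  by rewrite lerBrDr; apply: le_trans (lerD (lexx _) Eu) _; lra.
have dev := deviation_chebyshev mu1 (k ^ 4) p01 k30 hp.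
apply: le_trans (le_trans _ dev) _; last first.
  by rewrite natrX (_ : _ / _ = k%:R ^- 2)//; field; rewrite gt_eqF.
apply: (le_pr mu1) => //; first exact: measurable_typical.
apply: (@determined_by_measurable _ (k ^ 4 + size u)) => s t st.
by rewrite /= (eq_deviation _ _ (leqnn _) st).
Qed.

Lemma pr_bigcup_le mu (I : finType) (A : I -> set (digitseq q)) :
  mu setT = 1%E -> (forall i, measurable (A i)) ->
  pr mu (\bigcup_i A i) <= \sum_i pr mu (A i).
Proof.
move=> mu1 mA; have -> : \bigcup_i A i = \big[setU/set0]_(i : I) A i.
  rewrite -bigcup_seq; apply: eq_bigcupl; split=> i //= _.
  exact: mem_index_enum.
elim: (index_enum I) => [|i r IH]; first by rewrite !big_nil pr_set0.
rewrite !big_cons; set B := \big[_/_]_(_ <- r) _ in IH *.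
have mB : measurable B by exact: bigsetU_measurable.
have mAB : measurable (A i `|` B) by exact: measurableU.
rewrite (pr_split mu1 mAB (mA i)); apply: lerD.
  by apply: (le_pr mu1) => //; exact: measurableI.
apply: le_trans IH; apply: (le_pr mu1) => //; first exact: measurableD.
by move=> s [[]].
Qed.

End transition.

(** * Expansions in base q and the uniform law *)

Section expansion.
Context {R : realType} {q : nat} (q2 : (2 <= q)%N).
Local Notation D := (digit q).
Local Notation expansion := (expansion R).
Implicit Types (a b : nat -> D) (x y : R).

Let q_gt0 : (0 < q%:R :> R). Proof. by rewrite ltr0n (leq_trans _ q2). Qed.

Lemma digit_lt (c : D) : (c < q)%N.
Proof. by apply: leq_trans (ltn_ord c) _; rewrite prednK// (leq_trans _ q2). Qed.

Lemma expansion_cvg a :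
  series (fun n => (a n : nat)%:R / q%:R ^+ n.+1 : R) @ \oo --> expansion a.
Proof. exact: is_cvg_expansion. Qed.

Lemma expansion_ge0 a : 0 <= expansion a.
Proof.
apply: limr_ge; first exact: is_cvg_expansion.
near=> n; apply: sumr_ge0 => k _.
by rewrite divr_ge0// exprn_ge0// ltW.
Unshelve. all: by end_near. Qed.

Lemma expansion_le1 a : expansion a <= 1.
Proof.
apply: limr_le; first exact: is_cvg_expansion.
near=> n.
(* The bound is the partial sum for the constant digit q - 1, which telescopes. *)
have : series (fun n => (a n : nat)%:R / q%:R ^+ n.+1 : R) n <= 1 - q%:R ^- n.
  elim: (n : nat) => [|k IH]; first by rewrite /series/= big_geq// expr0 invr1 subrr.
  rewrite /series/= big_nat_recr//=; apply: le_trans (lerD IH (lexx _)) _.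
  rewrite exprS invfM mulrA.
  have : (a k : nat)%:R / q%:R <= 1 - q%:R^-1 :> R.
    rewrite ler_pdivrMr// mulrBl mul1r mulVf ?gt_eqF// lerBrDr natr1 ler_nat.
    exact: digit_lt.
  have : 0 <= q%:R ^- k :> R by rewrite invr_ge0 exprn_ge0// ltW.
  by move: (_ ^- k) ((a k : nat)%:R / q%:R) => r b *; nra.
move/le_trans; apply; rewrite gerBl invr_ge0 exprn_ge0// ltW//.
Unshelve. all: by end_near. Qed.

Lemma expansion_shift a :
  q%:R * expansion a = (a 0%N : nat)%:R + expansion (fun i => a i.+1).
Proof.
have h1 := @expansion_cvg (fun i => a i.+1).
have h2 : q%:R * series (fun n => (a n : nat)%:R / q%:R ^+ n.+1 : R) n.+1
    @[n --> \oo] --> q%:R * expansion a.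
  have h := @expansion_cvg a; rewrite -cvg_shiftS in h.
  exact: cvgM (cvg_cst _) h.
have h3 : (a 0%N : nat)%:R + series (fun n => (a n.+1 : nat)%:R / q%:R ^+ n.+1 : R) n
    @[n --> \oo] --> (a 0%N : nat)%:R + expansion (fun i => a i.+1).
  exact: cvgD (cvg_cst _) h1.
have E : (fun n => q%:R * series (fun n => (a n : nat)%:R / q%:R ^+ n.+1 : R) n.+1) =
    (fun n => (a 0%N : nat)%:R + series (fun n => (a n.+1 : nat)%:R / q%:R ^+ n.+1 : R) n).
  apply/funext => n; rewrite /series/= big_nat_recl// mulrDr expr1 mulrC divfK ?gt_eqF//.
  congr (_ + _); rewrite mulr_sumr; apply: eq_bigr => k _.
  by rewrite [in LHS]exprS; field; rewrite expf_neq0 ?gt_eqF.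
by rewrite E in h2; exact: (cvg_unique (@Rhausdorff R) h2 h3).
Qed.

(** Horner's scheme: the first [n] digits are read as an integer in base [q]. *)
Fixpoint prefix_value n a : nat :=
  if n is n'.+1 then (q * prefix_value n' a + a n')%N else 0%N.

Lemma expansion_prefix n a : q%:R ^+ n * expansion a =
  (prefix_value n a)%:R + expansion (fun i => a (n + i)%N).
Proof.
elim: n => [|n IH]; first by rewrite mul1r add0r.
rewrite exprS -mulrA IH mulrDr expansion_shift addn0/= natrD natrM -!addrA.
congr (_ + (_ + _)); congr expansion.
by apply/funext => i; rewrite addnS.
Qed.

Lemma eq_prefix_value n a b : mkseq a n = mkseq b n ->
  prefix_value n a = prefix_value n b.
Proof.
move=> /mkseq_eqP; elim: n => //= n IH ab; rewrite ab// IH// => i /ltnW iN.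
exact: ab.
Qed.

(** Division by [q] recovers the shorter prefix as quotient and the last digit as remainder. *)
Lemma prefix_value_inj n a b : prefix_value n a = prefix_value n b ->
  mkseq a n = mkseq b n.
Proof.
elim: n => //= n IH; rewrite !mkseqS => ab.
have q0 : (0 < q)%N by apply: leq_trans q2.
congr rcons.
  apply: IH; have /(congr1 (fun k => k %/ q)%N) := ab.
  by rewrite ![(q * _)%N]mulnC !divnMDl// !divn_small ?digit_lt// !addn0.
apply: val_inj; have /(congr1 (fun k => k %% q)%N) := ab.
by rewrite ![(q * _)%N]mulnC !modnMDl !modn_small ?digit_lt.
Qed.

Lemma expansion_close n a b : mkseq a n = mkseq b n ->
  `|expansion a - expansion b| <= q%:R^-1 ^+ n.
Proof.
move=> /eq_prefix_value ab.
have qn : 0 < q%:R ^+ n :> R by rewrite exprn_gt0.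
rewrite exprVn -[leRHS]mul1r ler_pdivlMr// -{1}(ger0_norm (ltW qn)) -normrM.
rewrite mulrC mulrBr !expansion_prefix ab.
have := expansion_ge0 (fun i => a (n + i)%N).
have := expansion_le1 (fun i => a (n + i)%N).
have := expansion_ge0 (fun i => b (n + i)%N).
have := expansion_le1 (fun i => b (n + i)%N).
by rewrite ler_norml; move: (expansion _) (expansion _) => u v *; apply/andP; split; lra.
Qed.

Lemma invq_pow_small (e : R) : 0 < e -> exists n, (q%:R^-1 : R) ^+ n < e.
Proof.
move=> e0.
have : (q%:R^-1 : R) ^+ n @[n --> \oo] --> 0.
  apply: cvg_expr; rewrite ger0_norm ?invr_ge0 ?ltW//.
  by rewrite invf_lt1// ltr1n.
move=> /cvgrPdist_lt /(_ _ e0) [n _ /(_ n (leqnn n))]/=.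
rewrite sub0r normrN ger0_norm ?exprn_ge0 ?invr_ge0 ?ltW// => h.
by exists n.
Qed.

(** For 0 <= x < 1, taking floors selects the expansion that does not end in the digit q - 1
    forever. *)
Definition digits x : nat -> D :=
  fun n => inord (Num.truncn (q%:R ^+ n.+1 * x) %% q).

Lemma digitsE x n : digits x n = (Num.truncn (q%:R ^+ n.+1 * x) %% q)%N :> nat.
Proof.
have q0 : (0 < q)%N by apply: leq_trans q2.
by rewrite /digits inordK// prednK// ltn_mod.
Qed.

Lemma truncn_div y : 0 <= y -> (Num.truncn (q%:R * y) %/ q)%N = Num.truncn y.
Proof.
move=> y0; have q0 : (0 < q)%N by apply: leq_trans q2.
apply/esym/truncn_def.
have /andP[l r] := truncn_itv (mulr_ge0 (ltW q_gt0) y0).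
set t := Num.truncn (q%:R * y) in l r *.
rewrite -(ler_pM2l q_gt0) -(ltr_pM2l q_gt0) -!natrM; apply/andP; split.
  by apply: le_trans l; rewrite ler_nat mulnC leq_trunc_div.
by apply: lt_le_trans r _; rewrite ler_nat mulnC; exact: ltn_ceil.
Qed.

Lemma prefix_value_digits x n : 0 <= x < 1 ->
  prefix_value n (digits x) = Num.truncn (q%:R ^+ n * x).
Proof.
move=> /andP[x0 x1]; elim: n => [|n IH] /=.
  by rewrite mul1r; apply/esym/truncn_def; rewrite x0.
rewrite IH digitsE exprS -mulrA.
have y0 : 0 <= q%:R ^+ n * x by rewrite mulr_ge0// exprn_ge0// ltW.
rewrite -(truncn_div y0).
by rewrite mulnC -divn_eq.
Qed.

Lemma digitsK x : 0 <= x < 1 -> expansion (digits x) = x.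
Proof.
move=> x01; apply/eqP; rewrite -subr_eq0 -normr_le0; apply/ler_addgt0Pl => e e0.
rewrite addr0; have [n /ltW ne] := invq_pow_small e0; apply: le_trans ne.
have qn : 0 < q%:R ^+ n :> R by rewrite exprn_gt0.
rewrite exprVn -[leRHS]mul1r ler_pdivlMr// -{1}(ger0_norm (ltW qn)) -normrM.
rewrite mulrC mulrBr expansion_prefix prefix_value_digits//.
have /andP[x0 _] := x01.
have /andP[] := truncn_itv (mulr_ge0 (ltW qn) x0); rewrite -natr1.
have := expansion_ge0 (fun i => digits x (n + i)%N).
have := expansion_le1 (fun i => digits x (n + i)%N).
by rewrite ler_norml; move: (expansion _) => u *; apply/andP; split; lra.
Qed.

Definition adic x := exists n k : nat, q%:R ^+ n * x = k%:R.

(** At a point that is not [q]-adic, [q%:R ^+ n * x] lies strictly between consecutive integers. The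
    radius is its distance to the nearer one, scaled back; any expansion that close to [x], even one
    ending in digits q - 1, has the same integer part after scaling. *)
Lemma digits_near x n : ~ adic x -> 0 <= x < 1 ->
  exists2 r : R, 0 < r &
    forall a, `|expansion a - x| < r -> mkseq a n = mkseq (digits x) n.
Proof.
move=> xadic x01; have /andP[x0 _] := x01.
have qn : 0 < q%:R ^+ n :> R by rewrite exprn_gt0.
have := truncn_itv (mulr_ge0 (ltW qn) x0).
rewrite -prefix_value_digits//; set t := prefix_value n (digits x) => /andP[tl tr].
have {}tl : t%:R < q%:R ^+ n * x.
  by rewrite lt_neqAle tl andbT; apply/eqP => tx; apply: xadic; exists n, t.
exists (Num.min (q%:R ^+ n * x - t%:R) (t.+1%:R - q%:R ^+ n * x) / q%:R ^+ n).
  by rewrite divr_gt0// lt_min !subr_gt0 tl.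
move=> a; rewrite ltr_pdivlMr// -{1}(ger0_norm (ltW qn)) -normrM mulrC mulrBr.
rewrite expansion_prefix lt_min => /andP[].
have := expansion_ge0 (fun i => a (n + i)%N).
have := expansion_le1 (fun i => a (n + i)%N).
move: (expansion _) => e e1 e0; rewrite !ltr_norml => /andP[h1 h2] /andP[h3 h4].
apply: prefix_value_inj; rewrite -/t; apply/eqP; rewrite eqn_leq.
rewrite -ltnS -[X in _ && X]ltnS -!(ltr_nat R) -!natr1.
by move: h1 h2 h3 h4; rewrite -natr1 => *; apply/andP; split; lra.
Qed.

End expansion.

(** * The uniform law on digit sequences *)

Section uniform_law.
Context {R : realType} {q : nat} (q2 : (2 <= q)%N).
Local Notation D := (digit q).
Local Notation expansion := (expansion R).
Local Notation digits := (@digits R q).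
Local Notation leb := (@lebesgue_measure R).
Implicit Types (mu : {measure set (digitseq q) -> \bar R}).

(** The sets determined by finitely many digits generate the sigma-algebra and are stable under
    intersection; on each of them a law is a finite sum of cylinder probabilities. *)
Lemma law_unique mu mu' : mu setT = 1%E -> mu' setT = 1%E ->
  (forall w, pr mu (cylinder w) = pr mu' (cylinder w)) ->
  forall A, measurable A -> mu A = mu' A.
Proof.
move=> mu1 mu1' H A mA.
pose G := [set A : set (digitseq q) | exists N, determined_by N A].
have GT : G setT by exists 0%N.
apply: (measure_unique G (fun=> setT)) => //.
- apply/seteqP; split=> B.
    apply: sub_sigma_algebra2 => C [n _ [V _ <-]]; exists n.+1 => s t st.
    rewrite setTI /=; move/mkseq_eqP : st => /(_ n (ltnSn n)).
    by rewrite /preimage/= => ->.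
  apply: smallest_sub; first exact: sigma_algebra_measurable.
  by move=> C [N] /determined_by_measurable.
- move=> B C [N dB] [M dC]; exists (maxn N M) => s t st [Bs Cs]; split.
    by apply: (determined_by_leq _ dB) Bs; [|exact: st]; rewrite leq_maxl.
  by apply: (determined_by_leq _ dC) Cs; [|exact: st]; rewrite leq_maxr.
- by rewrite bigcup_const.
- move=> B [N dB]; have mB := determined_by_measurable dB.
  rewrite -(prE mu1)// -(prE mu1')//; congr (_%:E).
  rewrite (pr_wordsum mu1 N mB) (pr_wordsum mu1' N mB); apply: eq_wordsum => w wN.
  have [Bw|Bw] := pselect (B (extend w)).
    rewrite (_ : B `&` _ = cylinder w)//; apply/seteqP; split=> s; first by case.
    by move=> ws; split=> //; apply: dB Bw; rewrite -wN mkseq_extend -[LHS]ws.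
  rewrite (_ : B `&` _ = set0) ?pr_set0// -subset0 => s [Bs ws].
  by apply: Bw; apply: dB Bs; rewrite -wN mkseq_extend -[RHS]ws.
- by move=> _; change (mu setT < +oo)%E; rewrite mu1 ltry.
Qed.

Lemma measurable_digits : measurable_fun setT (digits : R -> digitseq q).
Proof.
apply: measurability => // _ [_ [n _ [B _ <-]] <-]; rewrite !setTI.
pose t (x : R) := Num.truncn (q%:R ^+ n.+1 * x).
have mle k : measurable [set x | (t x <= k)%N].
  have qn : 0 < q%:R ^+ n.+1 :> R by rewrite exprn_gt0// ltr0n (leq_trans _ q2).
  rewrite (_ : [set x | _] = `]-oo, k.+1%:R / q%:R ^+ n.+1[%classic)//.
  by apply/seteqP; split=> x /=; rewrite in_itv/= /t truncn_le_nat ltr_pdivlMr// mulrC.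
have mt k : measurable [set x | t x = k].
  case: k => [|k].
    rewrite (_ : [set x | _] = [set x | (t x <= 0)%N])//.
    by apply/seteqP; split=> x /=; rewrite leqn0 => /eqP.
  rewrite (_ : [set x | _] = [set x | (t x <= k.+1)%N] `\` [set x | (t x <= k)%N]).
    exact: measurableD.
  apply/seteqP; split=> x /=; first by move=> ->; split=> //; rewrite ltnn.
  by move=> [xk /negP]; rewrite -ltnNge => kx; apply/eqP; rewrite eqn_leq xk.
rewrite (_ : _ @^-1` _ = \bigcup_(k in [set k | B (inord (k %% q))]) [set x | t x = k]).
  by rewrite bigcup_mkcond; apply: bigcupT_measurable => k; case: ifP.
apply/seteqP; split=> x /=; first by exists (t x).
by move=> [k /= Bk tk]; rewrite -tk in Bk.
Qed.

(** The null point 1 is dropped because [digitsK] holds on [0, 1) only. *)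
Lemma uniform_probE (A : set R) : measurable A ->
  uniform_prob (@ltr01 R) A = leb (A `&` `[0, 1[).
Proof.
move=> mA.
have E (B : set R) : measurable B -> uniform_prob (@ltr01 R) B = leb (B `&` `[0, 1]).
  move=> mB; rewrite /uniform_prob integral_uniform_pdf.
  have mB1 : measurable (B `&` `[0, 1]%classic) by exact: measurableI.
  rewrite (eq_integral (fun=> 1%E)) => [|y].
    by rewrite integral_cst// mul1e.
  by rewrite inE/= in_itv/= /uniform_pdf => -[_ ->]; rewrite subr0 invr1.
have mA1 := measurableI _ _ mA (measurable_itv `[0, 1]).
rewrite E// (measureDI leb mA1 (measurable_itv `[0, 1[)).
rewrite [X in (X + _)%E](_ : _ = 0%E) ?add0e.
  congr (leb _); rewrite -setIA; congr (_ `&` _).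
  apply/setIidr => x /=; rewrite !in_itv/= => /andP[-> /ltW ->]; by [].
apply/eqP; rewrite -measure_le0 -(lebesgue_measure_set1 (1 : R)).
rewrite le_measure ?inE//; first by apply: measurableD => //; exact: measurableI.
move=> x [[_ /=]]; rewrite !in_itv/= => /andP[-> x1] /negP; rewrite -leNgt => ?.
by apply/eqP; rewrite eq_le x1.
Qed.

(** This is the law of the digits of a uniform point. A cylinder of length n pulls back to a
    half-open [q]-adic interval of length q^(-n). *)
Lemma uniform_law_exists : exists lam : {measure set (digitseq q) -> \bar R},
  [/\ lam setT = 1%E,
    (forall A, measurable A -> lam A = leb ([set x | A (digits x)] `&` `[0, 1[)) &
    (forall w, pr lam (cylinder w) = q%:R^-1 ^+ size w)].
Proof.
pose lam : {measure set (digitseq q) -> \bar R} :=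
  measure_function_pushforward__canonical__measure_function_Measure
    (uniform_prob (@ltr01 R)) measurable_digits.
have lamE A : measurable A -> lam A = leb ([set x | A (digits x)] `&` `[0, 1[).
  move=> mA; rewrite /lam/= /pushforward uniform_probE//.
  by have := measurable_digits measurableT mA; rewrite setTI.
exists lam; split=> //.
  by rewrite lamE// setTI lebesgue_measure_itv/= lte01 sube0.
move=> w; rewrite /pr lamE; last exact: measurable_cylinder.
set v := prefix_value (size w) (extend w).
have qn : 0 < q%:R ^+ size w :> R by rewrite exprn_gt0// ltr0n (leq_trans _ q2).
have v1 : v.+1%:R / q%:R ^+ size w <= 1 :> R.
  rewrite ler_pdivrMr// mul1r -natrX ler_nat /v.
  elim: (size w) => //= n IH; rewrite expnS.
  apply: leq_trans (leq_mul (leqnn q) IH); rewrite mulnS addnC ltn_add2r.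
  exact: digit_lt.
rewrite (_ : _ `&` _ = `[v%:R / q%:R ^+ size w, v.+1%:R / q%:R ^+ size w[%classic); last first.
  have mk (x : R) : 0 <= x < 1 ->
      cylinder w (digits x) <-> v%:R <= q%:R ^+ size w * x < v.+1%:R.
    move=> x01; have /andP[x0 _] := x01.
    rewrite -truncn_eq ?mulr_ge0 ?(ltW qn)// -(prefix_value_digits q2)//.
    split; first by move=> wx; apply/eqP/eq_prefix_value; rewrite mkseq_extend.
    by move=> /eqP /(prefix_value_inj q2); rewrite mkseq_extend.
  apply/seteqP; split=> x /=; rewrite !in_itv/= ler_pdivrMr// ltr_pdivlMr// ![x * _]mulrC.
    by move=> [wx /mk[+ _]]; apply.
  move=> h; have x01 : 0 <= x < 1.
    case/andP: (h) => h1 h2; rewrite -(ler_pM2l qn) -(ltr_pM2l qn) mulr0 mulr1.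
    rewrite (le_trans _ h1)//= (lt_le_trans h2)//.
    by move: v1; rewrite ler_pdivrMr// mul1r.
  by split=> //; apply/(mk x x01).
rewrite lebesgue_measure_itv/= lte_fin ltr_pM2r ?invr_gt0// ltr_nat ltnSn/=.
by rewrite -mulrBl -natrB// subSnn mul1r exprVn.
Qed.

Lemma measurable_expansion_le (t : R) : measurable [set s : digitseq q | expansion s <= t].
Proof.
rewrite -[X in measurable X]setTI.
have := measurable_expansion q2 measurableT (measurable_itv `]-oo, t]).
by congr measurable; apply/seteqP; split=> s /=; rewrite in_itv.
Qed.

(** By uniqueness [mu] is the law of the digits of a uniform point, and [expansion] undoes
    [digits]. *)
Lemma uniform_law_cdf mu : mu setT = 1%E ->
  (forall w, pr mu (cylinder w) = q%:R^-1 ^+ size w) ->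
  forall t, pr mu [set s | expansion s <= t] = uniform_cdf t.
Proof.
move=> mu1 muq t; have [lam [lam1 lamE lamq]] := uniform_law_exists.
have mt := measurable_expansion_le t.
rewrite /pr (law_unique mu1 lam1)// => [|w]; last by rewrite muq lamq.
rewrite lamE// /uniform_cdf uniform_probE//; congr (fine (leb _)).
apply/seteqP; split=> x /= []; rewrite !in_itv/= => h x01; split=> //.
  by rewrite digitsK in h.
by rewrite digitsK.
Qed.

(** Under the uniform law every transition probability is 1 / q, so Chebyshev applies to each pair
    of a word shorter than [m] and a digit; [C] is the number of such pairs. *)
Lemma typical_uniform m mu : mu setT = 1%E ->
  (forall w, pr mu (cylinder w) = q%:R^-1 ^+ size w) ->
  exists C : R, forall k, (0 < k)%N -> pr mu (~` @typical R q m k) <= C / k%:R ^+ 2.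
Proof.
move=> mu1 muq; pose I : finType := ({l : 'I_m & l.-tuple D} * D)%type.
exists #|I|%:R => k k0.
have k0' : 0 < k%:R :> R by rewrite ltr0n.
pose A (i : I) : set (digitseq q) :=
  [set s | k%:R ^+ 3 <= `|deviation (tagged i.1) i.2 (q%:R^-1 : R) (k ^ 4) s|].
have mA i : measurable (A i).
  apply: (@determined_by_measurable _ (k ^ 4 + size (tagged i.1))) => s t st.
  by rewrite /A /= (eq_deviation _ _ (leqnn _) st).
have sub : ~` @typical R q m k `<=` \bigcup_i A i.
  move=> s /existsNP[u /existsNP[c /not_implyP[um /negP]]]; rewrite -leNgt => us.
  by exists (Tagged (fun l : 'I_m => l.-tuple D) (in_tuple u : (Ordinal um).-tuple D), c).
have mU : measurable (\bigcup_i A i).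
  by apply: fin_bigcup_measurable => //; exact: finite_finset.
apply: le_trans (le_pr mu1 _ mU sub) _; first by apply: measurableC; exact: measurable_typical.
apply: le_trans (pr_bigcup_le mu1 mA) _.
rewrite (_ : #|I|%:R / _ = \sum_(i : I) k%:R ^- 2); last by rewrite sumr_const mulr_natl.
apply: ler_sum => i _.
apply: le_trans (deviation_chebyshev mu1 (k ^ 4) (invq_itv01 q2) _ _) _.
- by rewrite exprn_gt0.
- by move=> v; rewrite !muq size_rcons exprS.
- by rewrite natrX (_ : _ / _ = k%:R ^- 2)//; field; rewrite gt_eqF.
Qed.

End uniform_law.

(** * Differentiation of singular laws *)

Section singular.
Context {R : realType} {q : nat} (q2 : (2 <= q)%N).
Local Notation D := (digit q).
Local Notation expansion := (expansion R).
Local Notation digits := (@digits R q).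
Local Notation leb := (@lebesgue_measure R).
Context (nu : {measure set (digitseq q) -> \bar R}) (nu_le1 : (nu setT <= 1)%E).

Lemma measurable_expansion_in (J : set R) : measurable J ->
  measurable [set s : digitseq q | J (expansion s)].
Proof. by move=> mJ; have := measurable_expansion q2 measurableT mJ; rewrite setTI. Qed.

Definition near_set (x r : R) : set (digitseq q) :=
  [set s | closed_ball x r (expansion s)].

Lemma measurable_near_set x r : measurable (near_set x r).
Proof. by apply: measurable_expansion_in; exact: measurable_closed_ball. Qed.

Lemma near_setE x r : 0 < r -> near_set x r = [set s | `|x - expansion s| <= r].
Proof. by move=> r0; rewrite /near_set closed_ballE. Qed.

(** These are points of positive upper density of the image of [nu] under [expansion], measured
    against the radius. *)
Definition dense_points (e : R) : set R :=
  [set x | forall r0 : R, 0 < r0 -> exists2 r, 0 < r < r0 &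
    ((e * r)%:E <= nu (near_set x r))%E].

(** Vitali's lemma extracts disjoint closed balls inside [E], of mass at least [e] times their
    radius, whose fivefold enlargements cover [A]. An enlarged ball has length ten times the radius,
    hence at most 10 / e times the mass, and disjointness bounds the total mass by that of [E]. *)
Lemma vitali_cover_bound (A : set R) (E : set (digitseq q)) (e : R) :
  0 < e -> measurable E ->
  (forall x, A x -> exists2 r0 : R, 0 < r0 & near_set x r0 `<=` E) ->
  A `<=` dense_points e ->
  exists U : set R, [/\ measurable U, A `<=` U & (leb U <= (10 / e)%:E * nu E)%E].
Proof.
move=> e0 mE AE Ae.
pose I := (R * {posnum R})%type.
pose B (i : I) := ball i.1 i.2%:num.
pose N (i : I) := near_set i.1 i.2%:num.
pose V := [set i : I | [/\ i.2%:num <= 1, N i `<=` E & ((e * i.2%:num)%:E <= nu (N i))%E]].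
have radB i : (radius (B i))%:num = i.2%:num by rewrite radius_ball_num.
have [|||S [cS SV tS coverS]] := @vitali_lemma_infinite_cover R I B V 1.
- by move=> i; exact: is_ball_ball.
- by move=> i; rewrite radB.
- by move=> i [i1 _ _]; rewrite radB.
have /countable_injP[f finj] := cS.
pose F i : set R := closure (5%:R *` B i).
(* The countable family is indexed by natural numbers through [f]; each index carries at most one
   ball. *)
pose G n : set R := \bigcup_(i in S `&` f @^-1` [set n]) F i.
pose H n : set (digitseq q) := \bigcup_(i in S `&` f @^-1` [set n]) N i.
have single n : (S `&` f @^-1` [set n] = set0) \/
    (exists2 i, S i & S `&` f @^-1` [set n] = [set i]).
  have [->|/set0P[i [Si fi]]] := eqVneq (S `&` f @^-1` [set n]) set0; first by left.
  right; exists i => //; apply/seteqP; split=> j.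
    by move=> [Sj fj]; apply: finj; rewrite ?inE// fi fj.
  by move=> ->.
have mF i : measurable (F i) by apply: closed_measurable; exact: closed_closure.
have mN i : measurable (N i) by exact: measurable_near_set.
have mG n : measurable (G n).
  by rewrite /G; have [->|[i _ ->]] := single n; rewrite ?bigcup_set0 ?bigcup_set1.
have mH n : measurable (H n).
  by rewrite /H; have [->|[i _ ->]] := single n; rewrite ?bigcup_set0 ?bigcup_set1.
have GH n : (leb (G n) <= (10 / e)%:E * nu (H n))%E.
  rewrite /G /H; have [->|[i /SV[_ _ Ni] ->]] := single n.
    by rewrite !bigcup_set0 !measure0 mule0.
  rewrite !bigcup_set1 /F scale_ballE// closure_ballE lebesgue_measure_closed_ball ?mulr_ge0//.
  rewrite (_ : (_ *+ 2) = 10 / e * (e * i.2%:num)); last by field; rewrite gt_eqF.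
  by rewrite EFinM lee_pmul2l// lte_fin divr_gt0.
exists (\bigcup_n G n); split.
- exact: bigcupT_measurable.
- move=> x Ax; have [r0 r00 xE] := AE x Ax.
  (* A radius below [r0] keeps the ball inside [E]; one below 1 respects the bound on radii in
     Vitali's lemma. *)
  have [|r /andP[rp rr0] rnu] := Ae x Ax (Num.min r0 1); first by rewrite lt_min r00 ltr01.
  have : cover S (closure \o scale_ball 5%:R \o B) x.
    apply: coverS; exists (x, PosNum rp); last first.
      by apply: subset_closure; exact: ballxx.
    move: rr0; rewrite lt_min => /andP[rr0 r1]; split=> //=; first exact: ltW.
    apply: subset_trans xE; rewrite /N/= !near_setE// => s /= /le_trans; apply.
    exact: ltW.
  by move=> [i Si xi]; exists (f i) => //; exists i.
- apply: (@le_trans _ _ (\sum_(n <oo) leb (G n))%E).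
    by apply: generalized_Boole_inequality => //; exact: bigcupT_measurable.
  apply: (@le_trans _ _ (\sum_(n <oo) (10 / e)%:E * nu (H n))%E).
    by apply: lee_nneseries => // n _; exact: GH.
  rewrite nneseriesZl// lee_pmul2l ?lte_fin ?divr_gt0//.
  rewrite -measure_semi_bigcup//; last 2 first.
  - apply/trivIsetP => n k _ _ nk; rewrite -subset0 => s [[i [Si fi] iN] [j [Sj fj] jN]].
    have ij : i = j.
      by apply: tS => //; exists (expansion s); split; rewrite /= closure_ballE.
    by move: nk; rewrite -fi -fj ij eqxx.
  - exact: bigcupT_measurable.
  apply: le_measure; rewrite ?inE//; first exact: bigcupT_measurable.
  by move=> s [n _ [i [/SV[_ NE _] _] /NE]].
Qed.

Let nuE A : measurable A -> (pr nu A)%:E = nu A.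
Proof.
move=> mA; rewrite /pr fineK// ge0_fin_numE// (@le_lt_trans _ _ 1%E) ?ltry//.
by apply: le_trans nu_le1; rewrite le_measure// inE.
Qed.

(** The mass between [x] and [y] lies in the closed ball about [x] that reaches [y]. *)
Lemma cdf_increment (x y : R) : x != y ->
  `|pr nu [set s | expansion s <= y] - pr nu [set s | expansion s <= x]| <=
  pr nu (near_set x `|x - y|).
Proof.
move=> xy.
have r0 : 0 < `|x - y| by rewrite normr_gt0 subr_eq0.
have mle := measurable_expansion_le q2; have mN := measurable_near_set x `|x - y|.
have step u v : [set s : digitseq q | expansion s <= u] `<=`
     [set s | expansion s <= v] `|` near_set x `|x - y| ->
    pr nu [set s | expansion s <= u] <=
    pr nu [set s | expansion s <= v] + pr nu (near_set x `|x - y|).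
  move=> uv; rewrite -lee_fin EFinD !nuE//.
  apply: le_trans (measureU2 _ _ _) => //.
  by rewrite le_measure ?inE//; exact: measurableU.
rewrite ler_distl; apply/andP; split.
  rewrite lerBlDr; apply: step => s /= sx.
  have [|sy] := leP (expansion s) y; [by move=> ?; left|right].
  by rewrite near_setE//= !ger0_norm; lra.
apply: step => s /= sx.
have [|sy] := leP (expansion s) x; [by move=> ?; left|right].
by rewrite near_setE//= !ler0_norm; lra.
Qed.

Lemma small_covers_negligible (A : set R) :
  (forall e : R, 0 < e -> exists U : set R,
     [/\ measurable U, A `<=` U & (leb U <= e%:E)%E]) ->
  leb.-negligible A.
Proof.
move=> h; have e0 (k : nat) : 0 < k.+1%:R^-1 :> R by rewrite invr_gt0.
pose U k := sval (cid (h _ (e0 k))).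
have UP k : [/\ measurable (U k), A `<=` U k & (leb (U k) <= k.+1%:R^-1%:E)%E].
  exact: svalP (cid (h _ (e0 k))).
have mU : measurable (\bigcap_k U k).
  by apply: bigcapT_measurable => k; have [] := UP k.
exists (\bigcap_k U k); split => //; last first.
  by move=> x Ax k _; have [_ AU _] := UP k; exact: AU.
apply/eqP; rewrite -measure_le0; apply/lee_addgt0Pr => e e1; rewrite add0e.
have [k ke] : exists k : nat, k.+1%:R^-1 <= e.
  exists (Num.truncn e^-1); rewrite invf_ple ?posrE//.
  by apply: ltW; exact: truncnS_gt.
have [mUk _ Uk] := UP k.
apply: (@le_trans _ _ (leb (U k))).
  by rewrite le_measure ?inE// => x; apply.
by apply: le_trans Uk _; rewrite lee_fin.
Qed.

Lemma adic_negligible : leb.-negligible (@adic R q).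
Proof.
have q0 : (q%:R : R) != 0 by rewrite pnatr_eq0; case: q q2.
rewrite (_ : @adic R q = \bigcup_n \bigcup_k [set k%:R / q%:R ^+ n]).
  apply: negligible_bigcup => n; apply: negligible_bigcup => k.
  by exists [set k%:R / q%:R ^+ n]; split=> //; exact: lebesgue_measure_set1.
apply/seteqP; split=> [x [n [k nk]]|x [n _ [k _ ->]]].
  by exists n => //; exists k => //=; rewrite -nk mulrAC divff ?mul1r ?expf_neq0.
by exists n, k; rewrite mulrC divfK// expf_neq0.
Qed.

(** Points whose digits lie in [E] have a ball inside [E] and fall under the Vitali bound; the
    others have small Lebesgue measure by hypothesis. *)
Lemma dense_points_negligible (e : R) : 0 < e ->
  (forall d : R, 0 < d -> exists N (E : set (digitseq q)), [/\ determined_by N E,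
     (leb ([set x | ~ E (digits x)] `&` `[0%R, 1%R[) <= d%:E)%E & (nu E <= d%:E)%E]) ->
  leb.-negligible ([set x | 0 <= x < 1 /\ ~ @adic R q x] `&` dense_points e).
Proof.
move=> e0 hE; apply: small_covers_negligible => d d0.
have c0 : 0 < 1 + 10 / e by rewrite addr_gt0// divr_gt0.
(* The two parts of the cover measure at most 10 / e times and once this amount, together [d]. *)
have [N [E [dE Ed nuEd]]] := hE (d / (1 + 10 / e)) ltac:(by rewrite divr_gt0).
have mE := determined_by_measurable dE.
pose A := [set x | 0 <= x < 1 /\ ~ @adic R q x] `&` dense_points e `&` [set x | E (digits x)].
have [|x [[_ ?] _]//|U [mU AU Ule]] := @vitali_cover_bound A E e e0 mE.
  move=> x [[[x01 xadic] _] Ex].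
  have [r r0 hr] := digits_near q2 N xadic x01.
  (* Halving passes from the strict inequality in [digits_near] to a closed ball. *)
  exists (r / 2); first by rewrite divr_gt0.
  move=> s; rewrite near_setE ?divr_gt0//= distrC => sx.
  have sr : `|expansion s - x| < r by apply: le_lt_trans sx _; lra.
  by apply: (dE (digits x)) => //; apply/esym/hr.
have mE' : measurable ([set x | ~ E (digits x)] `&` `[0%R, 1%R[).
  apply: measurableI => //.
  by have := measurable_digits (R := R) q2 measurableT (measurableC mE); rewrite setTI.
exists (U `|` ([set x | ~ E (digits x)] `&` `[0%R, 1%R[)); split.
- exact: measurableU.
- move=> x [[x01 xadic] xd]; have [Ex|Ex] := pselect (E (digits x)).
    by left; apply: AU.
  by right; split.
- apply: (@le_trans _ _ (leb U + leb ([set x | ~ E (digits x)] `&` `[0%R, 1%R[))%E).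
    exact: measureU2.
  apply: (@le_trans _ _ ((10 / e * (d / (1 + 10 / e)))%:E + (d / (1 + 10 / e))%:E)%E).
    apply: leeD => //; apply: (le_trans Ule).
    by rewrite [leRHS]EFinM lee_pmul2l// lte_fin divr_gt0.
  by rewrite -EFinD lee_fin le_eqVlt; apply/orP; left; apply/eqP; field; rewrite !gt_eqF//; lra.
Qed.

(** Off the [q]-adic points and the dense points for every e = 1 / (k + 1), small balls have mass
    below [e] times their radius, and [cdf_increment] bounds the difference quotients. *)
Lemma singular_derivative :
  (forall d : R, 0 < d -> exists N (E : set (digitseq q)), [/\ determined_by N E,
     (leb ([set x | ~ E (digits x)] `&` `[0%R, 1%R[) <= d%:E)%E & (nu E <= d%:E)%E]) ->
  {ae leb, forall x : R, 0 < x < 1 ->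
    is_derive x 1 (fun y => pr nu [set s | expansion s <= y]) 0}.
Proof.
move=> hE; have e0 (k : nat) : 0 < k.+1%:R^-1 :> R by rewrite invr_gt0.
have bad := negligibleU adic_negligible
  (negligible_bigcup (fun k => dense_points_negligible (e0 k) hE)).
apply: negligibleS bad => x /not_implyP[/andP[x0 x1] nd].
apply: contrapT => /not_orP[xadic xbad]; apply: nd.
set G := fun y => _.
suff h : h^-1 *: ((G \o shift x) (h *: 1) - G x) @[h --> 0^'] --> (0 : R).
  by split; [apply/cvg_ex; exists 0|exact: cvg_lim h].
apply/cvgr0Pnorm_le => e e1.
have [k ke] : exists k : nat, k.+1%:R^-1 <= e.
  exists (Num.truncn e^-1); rewrite invf_ple ?posrE//.
  by apply: ltW; exact: truncnS_gt.
have : ~ dense_points k.+1%:R^-1 x.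
  move=> xk; apply: xbad; exists k => //; split=> //; split=> //.
  by rewrite ltW.
move=> /existsNP[r0 /not_implyP[r00 /forall2NP hr]].
near=> h => /=.
have h0 : h != 0 by near: h; exact: nbhs_dnbhs_neq.
have hr0 : `|h| < r0.
  near: h; apply: dnbhs0_lt => //.
rewrite [_ *: 1]mulr1.
have xy : x != h + x by rewrite eq_sym -subr_eq0 addrK.
have := cdf_increment xy; rewrite (_ : x - (h + x) = - h); last by ring.
rewrite normrN => inc.
rewrite normrM normfV ler_pdivrMl ?normr_gt0//.
apply: le_trans inc _.
have [|] := hr `|h|; first by rewrite normr_gt0 h0.
move=> /negP; rewrite -ltNge -nuE ?lte_fin; last exact: measurable_near_set.
move=> /ltW /le_trans; apply.
by rewrite mulrC ler_wpM2l.
Unshelve. all: by end_near. Qed.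

End singular.

(** * Mixtures *)

Section cdf_points.
Context {R : realType} {q : nat} (q2 : (2 <= q)%N).
Local Notation expansion := (expansion R).
Context (mu : {measure set (digitseq q) -> \bar R}) (mu1 : mu setT = 1%E).

Let G (x : R) := pr mu [set s | expansion s <= x].

Let mu_le1 : (mu setT <= 1)%E. Proof. by rewrite mu1. Qed.

Lemma near_set_cvg (x : R) :
  pr mu (near_set x n.+1%:R^-1) @[n --> \oo] --> pr mu [set s | expansion s = x].
Proof.
have n0 n : 0 < n.+1%:R^-1 :> R by rewrite invr_gt0.
have E : \bigcap_n near_set x n.+1%:R^-1 = [set s : digitseq q | expansion s = x].
  apply/seteqP; split=> s /= h; last first.
    by move=> n _; rewrite near_setE//= h subrr normr0 ltW.
  apply/esym/eqP; rewrite -subr_eq0 -normr_le0; apply/ler_addgt0Pl => e e0; rewrite addr0.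
  have := h (Num.truncn e^-1) I; rewrite near_setE//= => /le_trans; apply.
  by rewrite invf_ple ?posrE//; apply: ltW; exact: truncnS_gt.
have mE : measurable [set s : digitseq q | expansion s = x].
  exact: (measurable_expansion_in q2 (measurable_set1 x)).
have : (mu \o (fun n => near_set x n.+1%:R^-1)) @ \oo --> mu (\bigcap_n near_set x n.+1%:R^-1).
  apply: nonincreasing_cvg_mu.
  - by rewrite -(prE mu1) ?ltry//; exact: measurable_near_set.
  - by move=> n; exact: measurable_near_set.
  - by rewrite E.
  - move=> n k nk; apply/subsetPset => s; rewrite !near_setE//= => /le_trans; apply.
    by rewrite lef_pV2 ?posrE// ler_nat ltnS.
rewrite E -(prE mu1 mE) => h; exact: fine_cvg h.
Qed.

Lemma discontinuous_cdf (x : R) :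
  discontinuous_at G x <-> 0 < pr mu [set s | expansion s = x].
Proof.
have mx : measurable [set s : digitseq q | expansion s = x].
  exact: (measurable_expansion_in q2 (measurable_set1 x)).
split.
  move=> dG; rewrite lt_neqAle pr_ge0 andbT; apply/eqP => p0; apply: dG.
  apply/cvgrPdist_le => e e0.
  have := @near_set_cvg x; rewrite -p0 => /cvgr0Pnorm_le /(_ _ e0) [n _ /(_ n (leqnn n))].
  rewrite /= ger0_norm ?pr_ge0// => ne.
  near=> y; have [->|yx] := eqVneq y x; first by rewrite subrr normr0 ltW.
  rewrite distrC; apply: le_trans (cdf_increment q2 mu_le1 _) _; first by rewrite eq_sym.
  apply: le_trans ne; apply: (le_pr mu1).
    exact: measurable_near_set.
    exact: measurable_near_set.
  have xy0 : 0 < `|x - y| by rewrite normr_gt0 subr_eq0 eq_sym.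
  move=> s; rewrite !near_setE ?invr_gt0//= => /le_trans; apply.
  by near: y; apply: cvgr_dist_le; rewrite ?invr_gt0.
(* Every increment of [G] from a point on the left up to [x] is at least the mass at [x]; the point
   [x - r / 2] contradicts continuity with that mass as tolerance. *)
move=> p0 cG.
have /cvgrPdist_lt /(_ _ p0) [r /= r0 hr] := cG.
have := hr (x - r / 2).
rewrite /ball_/= (_ : x - (x - r / 2) = r / 2); last by ring.
rewrite gtr0_norm ?divr_gt0// => /(_ ltac:(lra)).
apply/negP; rewrite -leNgt; apply: le_trans (ler_norm _).
rewrite /G (pr_split mu1 (measurable_expansion_le q2 x)
  (measurable_expansion_le q2 (x - r / 2))).
rewrite (_ : _ `&` _ = [set s | expansion s <= x - r / 2]); last first.
  by apply/setIidr => s /= h; apply: le_trans h _; rewrite gerBl ltW// divr_gt0.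
rewrite addrAC subrr add0r; apply: (le_pr mu1) => //.
  by apply: measurableD; exact: measurable_expansion_le.
move=> s /= ->; split=> //=; apply/negP; rewrite -ltNge gtrBl divr_gt0//.
Unshelve. all: by end_near. Qed.

Lemma strictly_increasing_cdf (x : R) :
  strictly_increasing_at G x <-> (forall r : R, 0 < r -> 0 < pr mu (near_set x r)).
Proof.
split=> [h r r0|h s t sx xt].
  have /h : x - r < x by rewrite gtrBl.
  move=> /(_ (x + r)); rewrite ltrDl => /(_ r0).
  rewrite -subr_gt0 => /lt_le_trans; apply.
  rewrite /G (pr_split mu1 (measurable_expansion_le q2 (x + r))
    (measurable_expansion_le q2 (x - r))).
  rewrite (_ : _ `&` _ = [set s | expansion s <= x - r]); last first.
    by apply/setIidr => s /= sx; apply: le_trans sx _; lra.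
  rewrite addrAC subrr add0r; apply: (le_pr mu1); last 2 first.
  - exact: measurable_near_set.
  - move=> s [/= sx /negP]; rewrite -ltNge => xs.
    by rewrite near_setE//= ler_norml; apply/andP; split; lra.
  - by apply: measurableD; exact: measurable_expansion_le.
(* Half the smaller distance keeps the closed ball strictly between [s] and [t]. *)
pose r := Num.min (x - s) (t - x) / 2.
have m0 : 0 < Num.min (x - s) (t - x) by rewrite lt_min !subr_gt0 sx.
have r0 : 0 < r by rewrite divr_gt0.
have [rs rt] : r < x - s /\ r < t - x.
  have : Num.min (x - s) (t - x) <= x - s by rewrite ge_min lexx.
  have : Num.min (x - s) (t - x) <= t - x by rewrite ge_min lexx orbT.
  by rewrite /r => *; split; lra.
rewrite -subr_gt0; apply: lt_le_trans (h r r0) _.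
rewrite /G (pr_split mu1 (measurable_expansion_le q2 t) (measurable_expansion_le q2 s)).
rewrite (_ : _ `&` _ = [set a | expansion a <= s]); last first.
  by apply/setIidr => a /= ax; apply: le_trans ax _; lra.
rewrite addrAC subrr add0r; apply: (le_pr mu1).
- exact: measurable_near_set.
- by apply: measurableD; exact: measurable_expansion_le.
- move=> a; rewrite near_setE//= ler_norml => /andP[a1 a2]; split=> /=; first lra.
  by apply/negP; rewrite -ltNge; lra.
Qed.

End cdf_points.

(** * Supports of stationary Markov laws *)

Section support.
Context {R : realType} {q m : nat} (q2 : (2 <= q)%N) (m0 : (0 < m)%N).
Implicit Types mu : {measure set (digitseq q) -> \bar R}.

(* Only the set of positive words of length m enters the hypothesis, so the
   support takes finitely many values. *)
Lemma near_set_support mu mu' (x r : R) : stationary_markov m mu ->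
  stationary_markov m mu' ->
  (forall w, size w = m -> 0 < pr mu (cylinder w) -> 0 < pr mu' (cylinder w)) ->
  0 < r -> 0 < pr mu (near_set x (r / 2)) -> 0 < pr mu' (near_set x r).
Proof.
move=> mumk mumk' H r0 p0.
have r2 : 0 < r / 2 by rewrite divr_gt0.
(* Expansions within a cylinder of length [N] differ by less than r / 2, so a cylinder meeting the
   smaller ball lies in the larger one. *)
have [N Nr] := invq_pow_small q2 r2.
have [mu1 _ _] := mumk; have [mu1' _ _] := mumk'.
have mN := measurable_near_set q2 x (r / 2).
move: p0; rewrite (pr_wordsum mu1 N mN) => /wordsum_gt0_ex[w wN wp].
have [s [sx sw]] : near_set x (r / 2) `&` cylinder w !=set0.
  by apply/set0P/eqP => e; rewrite e pr_set0 ltxx in wp.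
have wp' : 0 < pr mu (cylinder w).
  apply: lt_le_trans wp _; apply: (le_pr mu1) => //; last exact: measurable_cylinder.
  by apply: measurableI => //; exact: measurable_cylinder.
apply: lt_le_trans (positive_cylinders m0 mumk mumk' H wp') _.
apply: (le_pr mu1'); [exact: measurable_cylinder|exact: measurable_near_set|].
move=> t tw; rewrite near_setE//=.
move: sx; rewrite near_setE//= => sx.
have st : mkseq s (size w) = mkseq t (size w) by rewrite [LHS]sw [RHS]tw.
have := expansion_close (R := R) q2 st; rewrite wN => ste.
rewrite (_ : x - _ = (x - expansion R s) + (expansion R s - expansion R t)); last by ring.
apply: le_trans (ler_normD _ _) (le_trans (lerD sx (le_trans ste (ltW Nr))) _).
by rewrite -splitr.
Qed.

End support.

(** * The law of the sequence on an event of the mixing variable *)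

Section mixture.
Context {R : realType} {q : nat} {dT dO : measure_display}
  {T : measurableType dT} {Om : measurableType dO} {P : probability T R}.
Context (Pi : {RV P >-> Om}) (X : nat -> {RV P >-> digit q}).
Context (kappa : R.-pker Om ~> digitseq q).
Context (hkappa : conditional_distribution X Pi kappa).
Local Notation expansion := (expansion R).
Local Notation dist := (distribution P Pi).

(** Restricting [P] to the event and pushing forward along the path gives a measure at once;
    [hkappa] identifies it with the integral of the kernel. *)
Lemma conditioned_law (W : set Om) : measurable W ->
  exists nu : {measure set (digitseq q) -> \bar R},
    forall C, measurable C ->
      nu C = P (Pi @^-1` W `&` [set t | C (fun n => X n t)]) /\
      nu C = (\int[dist]_(p in W) kappa p C)%E.
Proof.
move=> mW; have mPW : measurable (Pi @^-1` W) by exact: measurable_funPTI.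
pose nu : {measure set (digitseq q) -> \bar R} :=
  measure_function_pushforward__canonical__measure_function_Measure
    (measure_function_mrestr__canonical__measure_function_Measure P mPW)
    (measurable_path X).
exists nu => C mC; rewrite -hkappa//; split=> //.
  by rewrite setIC.
by rewrite setIC.
Qed.

Lemma integral_kernel_eq0 (W : set Om) (C : set (digitseq q)) :
  measurable W -> measurable C ->
  (\int[dist]_(p in W) kappa p C = 0)%E <->
  {ae dist, forall p, W p -> kappa p C = 0%E}.
Proof.
move=> mW mC.
have mk : measurable_fun W (kappa ^~ C).
  by apply: measurable_funTS; exact: measurable_kernel.
have [h1 h2] := ae_eq_integral_abs dist mW mk.
have E : (\int[dist]_(p in W) `|kappa p C| = \int[dist]_(p in W) kappa p C)%E.
  by apply: eq_integral => p _; rewrite gee0_abs.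
by rewrite E in h1 h2; split.
Qed.

Lemma distribution_gt0_ae (B : set Om) : measurable B ->
  {ae dist, forall p, ~ B p} <-> ~ (0 < P (Pi @^-1` B))%E.
Proof.
move=> mB; split.
  move=> [N [mN N0 BN]]; apply/negP; rewrite -leNgt -N0.
  apply: (@le_measure _ _ _ dist); rewrite ?inE// => p Bp.
  by apply: BN => /=; exact.
move=> /negP; rewrite -leNgt => B0; exists B; split=> //.
  by apply/eqP; rewrite -measure_le0.
by move=> p /contrapT.
Qed.

End mixture.

(** * The three claims for the mixture *)

Section main.
Context {R : realType} {q m : nat} {dT dO : measure_display}
  {T : measurableType dT} {Om : measurableType dO} {P : probability T R}.
Context (Pi : {RV P >-> Om}) (X : nat -> {RV P >-> digit q}).
Context (kappa : R.-pker Om ~> digitseq q).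
Context (q2 : (2 <= q)%N) (m0 : (1 <= m)%N).
Context (hkappa : conditional_distribution X Pi kappa).
Local Notation expansion := (expansion R).
Local Notation dist := (distribution P Pi).
Local Notation F := (cdf_expansion X).

Let kappa1 p : kappa p setT = 1%E. Proof. exact: prob_kernel. Qed.

(** The third clause, applied to a single point for (I) and to balls around it for (II), carries
    positivity between the mixture and the conditional laws. *)
Lemma law_exists : exists law : {measure set (digitseq q) -> \bar R},
  [/\ law setT = 1%E,
     (forall x, F x = pr law [set s | expansion s <= x]) &
     (forall C, measurable C -> 0 < pr law C <->
        ~ {ae dist, forall p, kappa p C = 0%E})].
Proof.
have [law lawE] := conditioned_law hkappa (@measurableT _ Om).
have law1 : law setT = 1%E.
  rewrite (lawE _ measurableT).1 preimage_setT setTI.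
  by rewrite (_ : [set _ | _] = setT) ?probability_setT//; apply/seteqP; split.
exists law; split=> //.
  move=> x; have mx := measurable_expansion_le (R := R) q2 x.
  by rewrite /pr (lawE _ mx).1 preimage_setT setTI.
move=> C mC; have := integral_kernel_eq0 Pi kappa (@measurableT _ Om) mC.
rewrite -(lawE _ mC).2 -(prE law1 mC) => h0.
have {}h0 : pr law C = 0 <-> {ae dist, forall p, kappa p C = 0%E}.
  split.
    move=> e; rewrite e in h0; have [+ _] := h0 => /(_ erefl).
    by apply: filterS => p; apply.
  by move=> h; apply: EFin_inj; apply: (h0.2 _); apply: filterS h => p ? _.
rewrite -h0; split; first by move=> p0 p1; rewrite p1 ltxx in p0.
by move=> /eqP n0; rewrite lt_neqAle eq_sym n0 pr_ge0.
Qed.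

Lemma discontinuity_mixture (x : R) : measurable (discontinuity_event kappa x) ->
  discontinuous_at F x <-> (0 < P (Pi @^-1` discontinuity_event kappa x))%E.
Proof.
move=> mA; have [law [law1 FE law0]] := law_exists.
have mx : measurable [set s : digitseq q | expansion s = x].
  exact: (measurable_expansion_in q2 (measurable_set1 x)).
rewrite (_ : F = fun y => pr law [set s | expansion s <= y]); last exact/funext.
rewrite (discontinuous_cdf q2 law1) law0//.
have [h1 h2] := distribution_gt0_ae Pi mA.
have AE p : kappa p [set s | expansion s = x] = 0%E <-> ~ discontinuity_event kappa x p.
  have := discontinuous_cdf q2 (kappa1 p) x; rewrite /discontinuity_event/=.
  rewrite /cdf_given -[discontinuous_at _ _]/(discontinuous_at
    (fun y => pr (kappa p) [set s | expansion s <= y]) x).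
  move=> ->; split; first by rewrite /pr => ->; rewrite ltxx.
  move=> /negP; rewrite -leNgt => p0; rewrite -(prE (kappa1 p))//.
  by congr (_%:E); apply/eqP; rewrite eq_le p0 pr_ge0.
split.
  move=> n0; apply: contrapT => /h2 h; apply: n0.
  by apply: filterS h => p /AE.
by move=> n0 h; apply: (h1 _ n0); apply: filterS h => p /AE.
Qed.

Lemma increase_mixture (x : R) : measurable (increase_event kappa x) ->
  {ae dist, forall p, stationary (kappa p) /\ markov_chain m (kappa p)} ->
  strictly_increasing_at F x <-> (0 < P (Pi @^-1` increase_event kappa x))%E.
Proof.
move=> mB mk; have [law [law1 FE law0]] := law_exists.
rewrite (_ : F = fun y => pr law [set s | expansion s <= y]); last exact/funext.
rewrite (strictly_increasing_cdf q2 law1).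
have [h1 h2] := distribution_gt0_ae Pi mB.
have BE p : increase_event kappa x p <->
    (forall r : R, 0 < r -> 0 < pr (kappa p) (near_set x r)).
  have := strictly_increasing_cdf q2 (kappa1 p) x; apply.
have mN r := measurable_near_set q2 x r.
split; last first.
  move=> B0 r r0; apply/(law0 _ (mN r)) => h; apply: (h1 _ B0).
  by apply: filterS h => p p0 /BE/(_ r r0); rewrite /pr p0 ltxx.
move=> inc; apply: contrapT => /h2 notB.
pose good p := [/\ stationary_markov m (kappa p) & ~ increase_event kappa x p].
(* The type records which words of length [m] are positive; it takes finitely many values. *)
pose type p := [ffun w : m.-tuple (digit q) => 0 < pr (kappa p) (cylinder w)].
(* A null ball for one good parameter is, at half the radius, null for all good parameters of the
   same type. *)
have rad tau : exists r : R, 0 < r /\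
    forall p, good p -> type p = tau -> pr (kappa p) (near_set x r) = 0.
  have [[p0 [[mk0 nB0] t0]]|none] := pselect (exists p, good p /\ type p = tau); last first.
    (* The radius 1 is a default for a type that no good parameter has. *)
    by exists 1; split=> // p gp tp; exfalso; apply: none; exists p.
  have /existsNP[r /not_implyP[r0 /negP]] :
    ~ (forall r : R, 0 < r -> 0 < pr (kappa p0) (near_set x r)).
    by move=> /BE.
  rewrite -leNgt => pr0; exists (r / 2); split; first by rewrite divr_gt0.
  move=> p [mkp _] tp; apply/eqP; rewrite eq_le pr_ge0 andbT leNgt.
  apply/negP => pp; move: pr0; rewrite leNgt => /negP; apply.
  apply: (near_set_support q2 m0 mkp mk0 _ r0 pp) => w wm wp.
  have : type p (Tuple (introT eqP wm)) by rewrite ffunE.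
  by rewrite tp -t0 ffunE.
pose rho tau := sval (cid (rad tau)).
have rhoP tau : 0 < rho tau /\
    forall p, good p -> type p = tau -> pr (kappa p) (near_set x (rho tau)) = 0.
  exact: svalP (cid (rad tau)).
(* A minimum over finitely many types stays positive, and its ball is null for every good
   parameter. *)
pose r := \big[Order.min/1]_tau rho tau.
have r0 : 0 < r by apply/bigmin_gtP; split=> // tau _; exact: (rhoP tau).1.
move/(law0 _ (mN r)): (inc r r0); apply.
apply: filterS2 mk notB => p [st mkp] nB.
have gp : good p by split=> //; split.
have rr : r <= rho (type p) by exact: bigmin_le.
have [rp0 rhop] := rhoP (type p).
rewrite -(prE (kappa1 p) (mN r)); congr (_%:E); apply/eqP.
rewrite eq_le pr_ge0 andbT -(rhop p gp erefl).
apply: (le_pr (kappa1 p)) => // s; rewrite !near_setE//= => /le_trans; exact.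
Qed.

(** For almost every [p] outside the uniform event the mass tends to 0, at a speed depending on [p];
    dominated convergence with bound 1 passes to the integral. *)
Lemma typical_mass_cvg :
  {ae dist, forall p, stationary (kappa p) /\ markov_chain m (kappa p)} ->
  measurable (uniform_event kappa) ->
  (\int[dist]_(p in ~` uniform_event kappa) kappa p (@typical R q m k))%E @[k --> \oo] --> 0%E.
Proof.
move=> mk mU.
have mD : measurable (~` uniform_event kappa) by exact: measurableC.
have [||| _ _] := @dominated_convergence _ _ R dist _ mD
  (fun k p => kappa p (@typical R q m k)) (cst 0%E) (cst 1%E)
  (fun k => measurable_funTS (measurable_kernel kappa _ (@measurable_typical R q m k)))
  (measurable_cst _).
- apply: filterS mk => p [st mkp] nU.
  (* If all cylinders had their uniform probabilities, [uniform_law_cdf] would put [p] in the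
     uniform event. *)
  have [|K hK] := typical_pr q2 m0 (And3 (kappa1 p) st mkp).
    apply: contrapT => /forallNP H; apply: nU; rewrite /uniform_event/=.
    apply/funext => y; apply: (uniform_law_cdf q2 (kappa1 p)) => w.
    by apply/eqP/negPn/negP; exact: H.
  have E k : kappa p (@typical R q m k) = (pr (kappa p) (@typical R q m k))%:E.
    by rewrite prE//; exact: measurable_typical.
  rewrite (eq_cvg _ _ E); apply: cvg_EFin; first exact: nearW.
  apply: (@squeeze_cvgr _ _ _ _ (cst 0) (fun k => k%:R^-1)); last 2 first.
  + exact: cvg_cst.
  + by rewrite -cvg_shiftS; exact: cvg_harmonic.
  near=> k; rewrite pr_ge0/=.
  have kK : (K <= k)%N by near: k; exact: nbhs_infty_ge.
  have k0 : (0 < k)%N by near: k; exact: nbhs_infty_gt.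
  apply: le_trans (hK k kK) _.
  rewrite lef_pV2 ?posrE ?exprn_gt0 ?ltr0n// expr2 ler_peMr ?ler1n//.
- by apply: finite_measure_integrable_cst.
- apply: aeW => p k _; rewrite gee0_abs// -(kappa1 p).
  by apply: le_measure; rewrite ?inE//; exact: measurable_typical.
by rewrite integral0.
Unshelve. all: end_near. Qed.

Lemma derivative_mixture :
  {ae dist, forall p, stationary (kappa p) /\ markov_chain m (kappa p)} ->
  measurable (uniform_event kappa) ->
  {ae lebesgue_measure, forall x : R, x \in `[0, 1] ->
    is_derive x 1 F (fine (P (Pi @^-1` uniform_event kappa)))}.
Proof.
move=> mk mU; have mD := measurableC mU.
have [nu nuE] := conditioned_law hkappa mD.
have nu1 : (nu setT <= 1)%E.
  rewrite (nuE _ measurableT).1 (_ : _ `&` _ = Pi @^-1` (~` uniform_event kappa)).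
    by rewrite probability_le1//; exact: measurable_funPTI.
  by apply/seteqP; split=> t //= [].
have [lam [lam1 lamE lamq]] := uniform_law_exists (R := R) q2.
have [C hC] := typical_uniform q2 m lam1 lamq.
(* One [typical k] with [k] large meets both bounds: [typical_uniform] controls its complement under
   the uniform law, [typical_mass_cvg] its mass under [nu]. *)
have cov (d : R) : 0 < d -> exists N (E : set (digitseq q)), [/\ determined_by N E,
     (lebesgue_measure ([set x | ~ E (@digits R q x)] `&` `[0%R, 1%R[) <= d%:E)%E &
     (nu E <= d%:E)%E].
  move=> d0.
  have [K1 _ hK1] : \forall k \near \oo, (nu (@typical R q m k) <= d%:E)%E.
    have /fine_cvgP[_ /cvgr0Pnorm_le /(_ _ d0)] := typical_mass_cvg mk mU.
    apply: filterS => k /= kd.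
    have mT := @measurable_typical R q m k.
    have fnu : nu (@typical R q m k) \is a fin_num.
      rewrite ge0_fin_numE// (@le_lt_trans _ _ 1%E) ?ltry// (le_trans _ nu1)//.
      by rewrite le_measure ?inE.
    by rewrite -(fineK fnu) lee_fin (nuE _ mT).2; apply: le_trans (ler_norm _) kd.
  have [K2 hK2] : exists K2 : nat, forall k, (K2 <= k)%N -> C / k%:R ^+ 2 <= d.
    exists (Num.truncn (C / d)).+1 => k Kk.
    have k0 : 0 < k%:R :> R by rewrite ltr0n; case: k Kk.
    rewrite ler_pdivrMr ?exprn_gt0// mulrC -ler_pdivrMr//.
    apply: (@le_trans _ _ k%:R).
      by apply/ltW/(lt_le_trans (truncnS_gt _)); rewrite ler_nat.
    rewrite expr2; apply: ler_peMr; first exact: ltW.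
    by rewrite ler1n; case: k Kk {k0}.
  pose k := (maxn K1 K2).+1.
  exists (k ^ 4 + m)%N, (@typical R q m k); split.
  - exact: determined_by_typical.
  - have mT : measurable (~` @typical R q m k) by apply: measurableC; exact: measurable_typical.
    rewrite -(lamE _ mT) -(prE lam1 mT) lee_fin.
    apply: le_trans (hC k _) _ => //; apply: hK2.
    by rewrite /k ltnW// ltnS leq_maxr.
  - by apply: hK1; rewrite /= /k ltnW// ltnS leq_maxl.
have der := singular_derivative q2 nu1 cov.
pose c := fine (P (Pi @^-1` uniform_event kappa)).
(* Split along the uniform event: there the conditional CDF is the same for all parameters and
   integrates to [c] times it; the rest is [nu]. *)
have FE y : F y = c * uniform_cdf y + pr nu [set s | expansion s <= y].
  have mA := measurable_expansion_le (R := R) q2 y.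
  have mpath (C' : set (digitseq q)) : measurable C' ->
      measurable [set t | C' (fun n => X n t)].
    by move=> mC; have := measurable_path X measurableT mC; rewrite setTI.
  have mPU : measurable (Pi @^-1` uniform_event kappa) by exact: measurable_funPTI.
  have [nuU nuUE] := conditioned_law hkappa mU.
  have fineP (A : set T) : measurable A -> P A = (fine (P A))%:E.
    by move=> mA'; rewrite fineK// fin_num_measure.
  apply: EFin_inj; rewrite /cdf_expansion -fineP; last exact: (mpath _ mA).
  rewrite (measureDI P (mpath _ mA) mPU) EFinD EFinM addeC /c; congr (_ + _)%E.
    rewrite /pr (nuE _ mA).1 -fineP; last first.
      by apply: measurableI; [exact: measurable_funPTI|exact: (mpath _ mA)].
    by rewrite setDE setIC.
  transitivity (nuU [set s | expansion s <= y]).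
    by rewrite (nuUE _ mA).1 setIC.
  rewrite (nuUE _ mA).2 -fineP//.
  rewrite muleC -(integral_cst (distribution P Pi) mU); apply: eq_integral => p.
  rewrite inE /uniform_event/= => /(congr1 (fun f => f y)) <-.
  by rewrite /cst /cdf_given -/(pr _ _) prE.
(* The end points are discarded: the derivative is two-sided, while the uniform CDF is the identity
   on [0, 1] only. *)
have e0 : lebesgue_measure.-negligible [set (0 : R); 1].
  exists [set 0; 1]; split=> //; first exact: measurableU.
  apply/eqP; rewrite -measure_le0.
  apply: (@le_trans _ _ (lebesgue_measure [set 0%R] + lebesgue_measure [set 1%R])%E).
    exact: measureU2.
  by rewrite !lebesgue_measure_set1 adde0.
apply: negligibleS (negligibleU e0 der) => x /= /not_implyP[x01 nd].
apply: contrapT => /not_orP[/not_orP[x0 x1] /contrapT dx]; apply: nd.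
have x01' : 0 < x < 1.
  move: x01; rewrite in_itv/= => /andP[h0 h1]; rewrite !lt_neqAle h0 h1 !andbT.
  by apply/andP; split; apply/eqP => xe; [apply: x0|apply: x1]; rewrite /= xe.
have /andP[h0 h1] := x01'.
apply: (@near_eq_is_derive _ _ _ (fun y => c * y + pr nu [set s | expansion s <= y])).
  near=> y; rewrite FE uniform_cdfE//.
  apply/andP; split.
    by apply: ltW; near: y; exact: (lt_nbhsr h0).
  by apply: ltW; near: y; exact: (lt_nbhsl h1).
have := dx x01' => {}dx.
by apply: is_derive_eq; rewrite addr0 [_ *: 1]mulr1.
Unshelve. all: end_near. Qed.

End main.

Theorem theorem5p1 (R : realType) (q m : nat) (dT : measure_display)
  (T : measurableType dT) (P : probability T R) (dO : measure_display)
  (Om : measurableType dO) (Pi : {RV P >-> Om}) (X : nat -> {RV P >-> digit q})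
  (kappa : R.-pker Om ~> digitseq q)
  (hq : (2 <= q)%N) (hm : (1 <= m)%N)
  (hkappa : conditional_distribution X Pi kappa)
  (hmarkov : {ae distribution P Pi, forall p,
     stationary (kappa p) /\ markov_chain m (kappa p)})
  (mA : forall x : R, x \in `[0, 1] -> measurable (discontinuity_event kappa x))
  (mB : forall x : R, x \in `[0, 1] -> measurable (increase_event kappa x))
  (mU : measurable (uniform_event kappa)) :
  let F := cdf_expansion X in
  [/\ forall x : R, x \in `[0, 1] ->
        (discontinuous_at F x <->
         (0 < P (Pi @^-1` discontinuity_event kappa x))%E),
      forall x : R, x \in `[0, 1] ->
        (strictly_increasing_at F x <->
         (0 < P (Pi @^-1` increase_event kappa x))%E) &
      {ae lebesgue_measure, forall x : R, x \in `[0, 1] ->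
        is_derive x 1 F (fine (P (Pi @^-1` uniform_event kappa)))}].
Proof.
split=> [x x01|x x01|].
- by apply: discontinuity_mixture => //; exact: mA.
- by apply: (increase_mixture hq hm) => //; exact: mB.
- exact: (derivative_mixture hq hm).
Qed.
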